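(* Let $R$ be a commutative Noetherian local ring and let $M$ and $N$ be nonzero finitely generated $R$-modules. If $N$ has reducible complexity, $\operatorname{w.g.d}_R(M)<\infty$, and $\operatorname{Ext}^i_R(M,N)=0$ for $i\gg 0$, then, writing $n=\operatorname{w.g.d}_R(M)$, (i) $\operatorname{Ext}^{n}_R(M,N)\cong \operatorname{Ext}^{n}_R(M,R)\otimes_R N$; (ii) $\operatorname{w.g.d}_R(M)=\sup\{i\mid \operatorname{Ext}^i_R(M,N)\neq 0\}$.
   Context: All modules are finitely generated over the commutative Noetherian local ring $R$. Weak Gorenstein dimension: $\operatorname{w.g.d}_R(M)=0$ if $\operatorname{Ext}^i_R(M,R)=0$ for all $i>0$; $\operatorname{w.g.d}_R(M)=t$ for an integer $t\geq 1$ if $\operatorname{Ext}^t_R(M,R)\neq 0$ and $\operatorname{Ext}^i_R(M,R)=0$ for all $i>t$; and $\operatorname{w.g.d}_R(M)=\infty$ if $\operatorname{Ext}^i_R(M,R)\neq 0$ for infinitely many $i>0$. Syzygies and complexity: let $\cdots\to F_{n+1}\to F_n\to\cdots\to F_0\to X\to 0$ be the minimal free resolution of an $R$-module $X$. The $n$-th syzygy $\Omega^n_R(X)$ is the cokernel of $F_{n+1}\to F_n$, and the $n$-th Betti number $\beta_n^R(X)$ is the rank of $F_n$. The complexity of $X$ is $\operatorname{cx}_R(X)=\inf\{i\in\mathbb{N}\cup\{0\}\mid \exists\,\gamma\in\mathbb{R}\text{ such that }\beta_n^R(X)\leq \gamma n^{i-1}\text{ for }n\gg 0\}$. The module $K_\eta$: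 let $\eta\in\operatorname{Ext}^*_R(X,Y)=\bigoplus_{i\ge 0}\operatorname{Ext}^i_R(X,Y)$ be homogeneous of positive degree $|\eta|$, represented by a map $f_\eta:\Omega^{|\eta|}_R(X)\to Y$. Then $K_\eta$ denotes the pushout of $f_\eta$ and the inclusion $\Omega^{|\eta|}_R(X)\hookrightarrow F_{|\eta|-1}$; up to isomorphism it does not depend on the choice of $f_\eta$, and there is an exact sequence $0\to Y\to K_\eta\to\Omega^{|\eta|-1}_R(X)\to 0$. Reducible complexity (inductive definition): (a) every $R$-module of finite projective dimension has reducible complexity; (b) an $R$-module $X$ of finite positive complexity has reducible complexity if there is a homogeneous element $\eta\in\operatorname{Ext}^*_R(X,X)$ of positive degree such that $\operatorname{cx}_R(K_\eta)<\operatorname{cx}_R(X)$, $\operatorname{depth}_R(X)=\operatorname{depth}_R(K_\eta)$, and $K_\eta$ has reducible complexity. *)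

(* Defs.v *)
From HB Require Import structures.
From mathcomp Require Import all_boot all_order all_algebra.
From mathcomp Require Import ring_quotient generic_quotient.
From mathcomp Require Import all_classical all_reals ereal Rstruct.
From mathcomp.multinomials Require Import freeg.

Set Implicit Arguments.
Unset Strict Implicit.
Unset Printing Implicit Defensive.

Import Order.TTheory GRing.Theory Num.Theory.
Local Open Scope classical_set_scope.
Local Open Scope quotient_scope.
Local Open Scope ring_scope.

Section Ideals.
Variable R : comNzRingType.

Definition ideal (I : set R) : Prop :=
  I 0 /\ forall a x y, I x -> I y -> I (a * x + y).

Definition maximal_ideal (I : set R) : Prop :=
  [/\ ideal I, ~ I 1 &
      forall J, ideal J -> I `<=` J -> ~ J 1 -> J `<=` I].

Definition fg_ideal (I : set R) : Prop :=
  exists k (g : 'I_k -> R),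
    forall x, I x <-> exists c : 'I_k -> R, x = \sum_i c i * g i.

End Ideals.

HB.mixin Record ComNzRing_isNoethLocal R of GRing.ComNzRing R := {
  maxid : set R;
  maxid_maximal : maximal_ideal maxid;
  maxid_unique : forall I : set R, maximal_ideal I -> I = maxid;
  noetherian : forall I : set R, ideal I -> fg_ideal I
}.

#[short(type="noethLocalRingType")]
HB.structure Definition NoethLocalRing :=
  {R of GRing.ComNzRing R & ComNzRing_isNoethLocal R}.

Section Modules.
Variable R : comNzRingType.
Implicit Types U V W X Y : lmodType R.

Definition trivial V : Prop := forall v : V, v = 0.

Definition isomorphic U V : Prop := exists f : {linear U -> V}, bijective f.

Definition finitely_generated V : Prop :=
  exists k (g : 'I_k -> V),
    forall v, exists c : 'I_k -> R, v = \sum_i c i *: g i.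

Section QuotientModule.
Variables (V : lmodType R) (S : {pred V}) (S_submod : submod_closed S).

Definition quotpred of submod_closed S : {pred V} := S.
HB.instance Definition _ := GRing.isZmodClosed.Build V (quotpred S_submod)
  (GRing.submod_closedB S_submod).

Definition quotpred_zmod : zmodClosed V :=
  GRing.ZmodClosed.clone V (quotpred S_submod) _.

Definition quotmod : Type := ring_quotient.Quotient.quot quotpred_zmod.
HB.instance Definition _ := GRing.Zmodule.on quotmod.

Definition quotpi (v : V) : quotmod := \pi_(ring_quotient.Quotient.quot quotpred_zmod) v.
Definition quotrepr (x : quotmod) : V := repr x.

Lemma quotreprK : cancel quotrepr quotpi.
Proof. exact: reprK. Qed.

Lemma quotpi_eq u v : quotpi u = quotpi v <-> u - v \in S.
Proof.
have := @ring_quotient.Quotient.idealrBE V quotpred_zmod u v.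
rewrite -[(u - v \in quotpred_zmod)]/(u - v \in S) => ->.
by split=> [e|/eqP //]; apply/eqP.
Qed.

Lemma quotpi_is_zmod_morphism : zmod_morphism quotpi.
Proof. exact: (@raddfB _ _ \pi_(ring_quotient.Quotient.quot quotpred_zmod)). Qed.
HB.instance Definition _ :=
  GRing.isZmodMorphism.Build V quotmod quotpi quotpi_is_zmod_morphism.

Definition quotscale (a : R) (x : quotmod) : quotmod :=
  quotpi (a *: quotrepr x).

Lemma quotscaleE a v : quotscale a (quotpi v) = quotpi (a *: v).
Proof.
apply/quotpi_eq; rewrite -scalerBr -[_ *: _]addr0.
case: S_submod => S0 SD; apply: SD => //.
by apply/quotpi_eq; rewrite quotreprK.
Qed.

Lemma quotscaleA a b x : quotscale a (quotscale b x) = quotscale (a * b) x.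
Proof. by rewrite -(quotreprK x) !quotscaleE scalerA. Qed.
Lemma quotscale1 : left_id 1 quotscale.
Proof. by move=> x; rewrite -(quotreprK x) quotscaleE scale1r. Qed.
Lemma quotscaleDr : right_distributive quotscale +%R.
Proof.
move=> a x y; rewrite -(quotreprK x) -(quotreprK y) -raddfD !quotscaleE.
by rewrite -raddfD scalerDr.
Qed.
Lemma quotscaleDl x : {morph quotscale^~ x : a b / a + b}.
Proof.
move=> a b; rewrite -(quotreprK x) /= !quotscaleE.
by rewrite -raddfD scalerDl.
Qed.
HB.instance Definition _ := GRing.Zmodule_isLmodule.Build R quotmod
  quotscaleA quotscale1 quotscaleDr quotscaleDl.

Lemma quotpi_is_scalable : scalable quotpi.
Proof. by move=> a v; rewrite -quotscaleE. Qed.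
HB.instance Definition _ :=
  GRing.isScalable.Build R V quotmod *:%R quotpi quotpi_is_scalable.

End QuotientModule.

Section KerCoker.
Variables (U V W : lmodType R).

Definition img (f : {linear U -> V}) : V -> bool :=
  fun v => `[< exists u, f u = v >].

Lemma img_submod f : submod_closed (img f).
Proof.
split=> [|a x y /asboolP[u <-] /asboolP[v <-]]; apply/asboolP.
  by exists 0; rewrite raddf0.
by exists (a *: u + v); rewrite linearP.
Qed.

Definition coker (f : {linear U -> V}) : lmodType R := quotmod (img_submod f).

Definition ker (g : {linear V -> W}) : V -> bool := fun v => g v == 0.

Lemma ker_submod g : submod_closed (ker g).
Proof.
split=> [|a x y /eqP gx /eqP gy]; apply/eqP; first by rewrite raddf0.
by rewrite linearP gx gy scaler0 addr0.
Qed.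
HB.instance Definition _ g :=
  GRing.isSubmodClosed.Build R V (ker g) (ker_submod g).

Definition kermod (g : {linear V -> W}) : Type := {v : V | v \in ker g}.
HB.instance Definition _ g := Choice.on (kermod g).
HB.instance Definition _ g := SubChoice.on (kermod g).
HB.instance Definition _ g := [SubChoice_isSubLmodule of kermod g by <:].

Definition boundary (f : {linear U -> V}) (g : {linear V -> W}) :
  kermod g -> bool := fun z => val z \in img f.
Arguments boundary : clear implicits.

Lemma boundary_submod f g : submod_closed (boundary f g).
Proof.
have [S0 SD] := img_submod f.
split=> [|a x y hx hy]; first by rewrite -[_ \in _]/(val 0 \in img f) raddf0.
by rewrite -[_ \in _]/(val _ \in img f) linearP; apply: SD.
Qed.

Definition homology (f : {linear U -> V}) (g : {linear V -> W}) : lmodType R :=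
  quotmod (boundary_submod f g).

End KerCoker.

Section Pushout.
Variables (W X Y : lmodType R) (f : {linear W -> X}) (g : {linear W -> Y}).

Definition pushout_rel (w : W) : X * Y := (f w, - g w).

Lemma pushout_rel_linear : linear pushout_rel.
Proof.
move=> a u v; rewrite /pushout_rel !linearP /=.
by congr (_, _); rewrite /= opprD scalerN.
Qed.
HB.instance Definition _ := GRing.isLinear.Build R W (X * Y)%type *:%R
  pushout_rel pushout_rel_linear.

Definition pushout : lmodType R := coker pushout_rel.

End Pushout.

Section Tensor.
Variables A B : lmodType R.

Definition tensor_rel (D : {freeg (A * B) / R}) : Prop :=
  (exists a a' b,
     D = << (a + a', b) >> - << (a, b) >> - << (a', b) >>) \/
  (exists a b b',
     D = << (a, b + b') >> - << (a, b) >> - << (a, b') >>) \/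
  (exists r a b, D = << (r *: a, b) >> - r *: << (a, b) >>) \/
  (exists r a b, D = << (a, r *: b) >> - r *: << (a, b) >>).

Definition tensor_null (D : {freeg (A * B) / R}) : bool :=
  `[< exists k (c : 'I_k -> R) (T : 'I_k -> {freeg (A * B) / R}),
        (forall i, tensor_rel (T i)) /\ D = \sum_i c i *: T i >].

Lemma tensor_null_submod : submod_closed tensor_null.
Proof.
split=> [|a x y /asboolP[k [c [T [hT ->]]]] /asboolP[l [d [S [hS ->]]]]];
  apply/asboolP.
  by exists 0, (fun=> 0), (fun=> 0); split=> [[]|]; rewrite ?big_ord0.
exists (k + l)%N,
  (fun i => match fintype.split i with inl i => a * c i | inr i => d i end),
  (fun i => match fintype.split i with inl i => T i | inr i => S i end).
split=> [i|]; first by case: fintype.split.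
rewrite big_split_ord /= scaler_sumr; congr (_ + _); apply: eq_bigr => i _.
  by rewrite (unsplitK (inl _ i)) scalerA.
by rewrite (unsplitK (inr _ i)).
Qed.

Definition tensor : lmodType R := quotmod tensor_null_submod.

End Tensor.

Section HomComplex.
Variables (p q : nat) (A : 'M[R]_(p, q)) (Y : lmodType R).

(* Hom_R(-, Y) applied to the map R^p -> R^q, u |-> u *m A, where Hom_R(R^q, Y)
   is identified with Y^q through the values on the standard basis. *)
Definition hom_dif (phi : {ffun 'I_q -> Y}) : {ffun 'I_p -> Y} :=
  [ffun i => \sum_j A i j *: phi j].

Lemma hom_dif_linear : linear hom_dif.
Proof.
move=> a u v; apply/ffunP => i; rewrite !ffunE scaler_sumr -big_split /=.
by apply: eq_bigr => j _; rewrite !ffunE scalerDr !scalerA mulrC.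
Qed.
HB.instance Definition _ := GRing.isLinear.Build R {ffun 'I_q -> Y}
  {ffun 'I_p -> Y} *:%R hom_dif hom_dif_linear.

End HomComplex.

(* A complex of finite free modules: in degree n the module of row vectors
   R^(rk n), with differential u |-> u *m dif n from degree n.+1 to n. *)
Record free_complex := FreeComplex {
  rk : nat -> nat;
  dif : forall n, 'M[R]_(rk n.+1, rk n);
  dif_dif : forall n, dif n.+1 *m dif n = 0
}.

HB.instance Definition _ := gen_eqMixin free_complex.
HB.instance Definition _ := gen_choiceMixin free_complex.

Definition free_complex0 : free_complex :=
  @FreeComplex (fun=> 0%N) (fun=> 0) (fun=> mulmx0 _ _).

Definition free_resolution V (F : free_complex) : Prop :=
  exists e : {linear 'rV[R]_(rk F 0) -> V},
    [/\ forall v, exists u, e u = v,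
        forall u, e u = 0 <-> exists w, u = w *m dif F 0 &
        forall n (u : 'rV_(rk F n.+1)),
          u *m dif F n = 0 <-> exists w, u = w *m dif F n.+1].

Definition projective V : Prop :=
  forall (A B : lmodType R) (g : {linear A -> B}) (h : {linear V -> B}),
    (forall b, exists a, g a = b) ->
    exists l : {linear V -> A}, forall v, g (l v) = h v.

(* As everywhere, only finitely generated modules are considered; over a
   Noetherian ring this does not change the projective dimension. *)
Definition finite_projective_dimension V : Prop :=
  exists (P : nat -> lmodType R) (d : forall n, {linear P n.+1 -> P n})
         (e : {linear P 0 -> V}) (k : nat),
    [/\ forall n, projective (P n) /\ finitely_generated (P n),
        forall n, (k < n)%N -> trivial (P n),
        forall v, exists u, e u = v,
        forall u, e u = 0 <-> exists w, u = d 0 w &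
        forall n u, d n u = 0 <-> exists w, u = d n.+1 w].

(* v lies in (s_0, ..., s_(k-1)) V, where k = size s. *)
Definition in_seq_submod V (s : seq R) (v : V) : Prop :=
  exists c : 'I_(size s) -> V, v = \sum_(i < size s) s`_i *: c i.

Definition regular_seq V (s : seq R) : Prop :=
  (forall i, (i < size s)%N -> forall v : V,
     in_seq_submod (take i s) (s`_i *: v) -> in_seq_submod (take i s) v) /\
  exists v : V, ~ in_seq_submod s v.

End Modules.

Arguments hom_dif {R p q} A Y phi.

Section Local.
Variable R : noethLocalRingType.
Implicit Types M N X Y : lmodType R.

Definition minimal_free_resolution X (F : free_complex R) : Prop :=
  free_resolution X F /\ forall n i j, maxid (dif F n i j).

(* Lemma min_resP below: this is a minimal free resolution of X as soon as X is
   finitely generated; the default value is then irrelevant. *)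
Definition min_res X : free_complex R :=
  xget (free_complex0 R) [set F | minimal_free_resolution X F].

Definition betti X (n : nat) : nat := rk (min_res X) n.

Definition Ext (i : nat) X Y : lmodType R :=
  let F := min_res X in
  match i with
  | 0 => homology (\0 : {linear Y -> {ffun 'I_(rk F 0) -> Y}})
                  (hom_dif (dif F 0) Y)
  | i.+1 => homology (hom_dif (dif F i) Y) (hom_dif (dif F i.+1) Y)
  end.

Definition syzygy (n : nat) X : lmodType R :=
  coker (mulmxr (dif (min_res X) n)
         : {linear 'rV_(betti X n.+1) -> 'rV_(betti X n)}).

(* The inclusion of the (n+1)-st syzygy in F_n, induced by the differential. *)
Definition syzygy_incl (n : nat) X (w : syzygy n.+1 X) : 'rV[R]_(betti X n) :=
  quotrepr w *m dif (min_res X) n.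

Definition syzygy_pi (n : nat) X (u : 'rV[R]_(betti X n)) : syzygy n X :=
  quotpi _ u.

Lemma syzygy_inclE n X u : syzygy_incl (@syzygy_pi n.+1 X u)
  = u *m dif (min_res X) n.
Proof.
apply/eqP; rewrite -subr_eq0 -mulmxBl.
have /quotpi_eq/asboolP[w <-] := quotreprK (syzygy_pi u).
by rewrite /= /mulmxr -mulmxA dif_dif mulmx0.
Qed.

Lemma syzygy_incl_linear n X : linear (@syzygy_incl n X).
Proof.
move=> a x y; rewrite -(quotreprK x) -(quotreprK y) -linearP.
by rewrite !syzygy_inclE mulmxDl scalemxAl.
Qed.
HB.instance Definition _ n X := GRing.isLinear.Build R (syzygy n.+1 X)
  'rV[R]_(betti X n) *:%R (@syzygy_incl n X) (@syzygy_incl_linear n X).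

(* f represents eta: composing f with F_{q+1} ->> Omega^{q+1} X gives a cocycle,
   of class eta. *)
Definition represents q X Y (f : {linear syzygy q.+1 X -> Y})
    (eta : Ext q.+1 X Y) : Prop :=
  exists z : kermod (hom_dif (dif (min_res X) q.+1) Y),
    val z = [ffun j => f (syzygy_pi (delta_mx 0 j))] /\ eta = quotpi _ z.

Definition Kmod q X Y (f : {linear syzygy q.+1 X -> Y}) : lmodType R :=
  pushout f (@syzygy_incl q X).

Definition complexity X : \bar Rdefinitions.R :=
  ereal_inf [set i%:R%:E | i in [set i : nat | exists gamma : Rdefinitions.R,
    \forall n \near \oo, (betti X n)%:R <= gamma * n%:R ^ (i%:Z - 1)]].

(* The zero module has infinite depth. *)
Definition depth X : \bar Rdefinitions.R :=
  if `[< trivial X >] then +oo%E else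
  ereal_sup [set (size s)%:R%:E | s in
    [set s : seq R | (forall x, x \in s -> maxid x) /\ regular_seq X s]].

Definition is_wgd X (w : \bar Rdefinitions.R) : Prop :=
  [\/ w = 0%E /\ forall i, (0 < i)%N -> trivial (Ext i X R^o),
      exists t : nat, [/\ w = t%:R%:E, (1 <= t)%N, ~ trivial (Ext t X R^o) &
                          forall i, (t < i)%N -> trivial (Ext i X R^o)] |
      w = +oo%E /\
      infinite_set [set i : nat | (0 < i)%N /\ ~ trivial (Ext i X R^o)]].

(* Lemma wgdP below: wgd X always satisfies is_wgd X. *)
Definition wgd X : \bar Rdefinitions.R := xget +oo%E [set w | is_wgd X w].

(* As q ranges over nat, eta ranges over the homogeneous elements of positive
   degree q.+1. *)
Inductive reducible_complexity : lmodType R -> Prop :=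
| RC_finite_pd X of finitely_generated X & finite_projective_dimension X :
    reducible_complexity X
| RC_step X (q : nat) (eta : Ext q.+1 X X) (f : {linear syzygy q.+1 X -> X}) of
    finitely_generated X &
    (0 < complexity X)%E & (complexity X < +oo)%E &
    represents f eta &
    (complexity (Kmod f) < complexity X)%E &
    depth X = depth (Kmod f) &
    reducible_complexity (Kmod f) :
    reducible_complexity X.

End Local.

Section MinimalResolution.
Variable R : noethLocalRingType.

Lemma notin_maxid (x : R) : ~ maxid x -> exists y, y * x = 1.
Proof.
move=> xm; apply: contrapT => xU.
have ideal_x : ideal [set a * x | a in [set: R]].
  split=> [|a _ _ [b _ <-] [c _ <-]]; first by exists 0; rewrite ?mul0r.
  by exists (a * b + c); rewrite // mulrDl mulrA.
pose P (J : set R) := J = set0 \/ [/\ ideal J, ~ J 1 & J x].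
have [|J [PJ Jmax]] := @Zorn_bigcup R P.
- move=> F FP Ftot.
  have [[J FJ [y Jy]]|F0] := pselect (exists2 J, F J & J !=set0); last first.
    left; rewrite -subset0 => y [J FJ Jy].
    by case: F0; exists J => //; exists y.
  have good K z : F K -> K z -> [/\ ideal K, ~ K 1 & K x].
    by move=> FK Kz; case: (FP K FK) => // K0; rewrite K0 in Kz.
  have [[J0 _] _ Jx] := good _ _ FJ Jy.
  right; split; [split| |]; [by exists J| |by case=> K FK K1; case: (good _ _ FK K1)|by exists J].
  move=> a u v [K FK Ku] [L FL Lv].
  have [KL|LK] := Ftot K L FK FL.
    by exists L => //; have [[_ LD] _ _] := good _ _ FL Lv; apply: LD => //; apply: KL.
  by exists K => //; have [[_ KD] _ _] := good _ _ FK Ku; apply: KD => //; apply: LK.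
have Px : P [set a * x | a in [set: R]].
  by right; split=> //; [case=> y _ yx; apply: xU; exists y|exists 1; rewrite ?mul1r].
case: PJ => [J0|[iJ J1 Jx]].
  apply: (Jmax _ _ Px); rewrite J0; split; first by [].
  by move=> /(_ x); apply; exists 1; rewrite ?mul1r.
apply: xm; rewrite -(maxid_unique J) //; split=> // K iK JK K1 y Ky.
apply: contrapT => Jy; apply: (Jmax K); last by right; split=> //; exact: JK.
by split=> // KJ; apply/Jy/KJ.
Qed.

Definition generates (V : lmodType R) (P : set V) k (g : 'I_k -> V) : Prop :=
  forall v, P v <-> exists c : 'I_k -> R, v = \sum_i c i *: g i.

Lemma minimal_generators (V : lmodType R) (P : set V) k (g : 'I_k -> V) :
  generates P g ->
  exists k' (g' : 'I_k' -> V), generates P g' /\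
    forall c : 'I_k' -> R, \sum_i c i *: g' i = 0 -> forall i, maxid (c i).
Proof.
elim: k g => [|k IHk] g gP; first by exists 0, g; split=> // c _ [].
have [cm|] := pselect (forall c : 'I_k.+1 -> R,
  \sum_i c i *: g i = 0 -> forall i, maxid (c i)); first by exists k.+1, g.
move=> /existsNP[c /not_implyP[c0 /existsNP[i /notin_maxid[y yc]]]].
apply: (IHk (fun j => g (fintype.lift i j))) => v; rewrite gP; split=> -[d ->].
  have gi : g i = \sum_j (- y * c (fintype.lift i j)) *: g (fintype.lift i j).
    have := congr1 (fun v => y *: v) c0; rewrite (bigD1_ord i) //= scaler0.
    rewrite scalerDr scalerA yc scale1r => /eqP; rewrite addr_eq0 => /eqP ->.
    rewrite scaler_sumr -sumrN; apply: eq_bigr => j _.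
    by rewrite scalerA mulNr scaleNr.
  exists (fun j => d (fintype.lift i j) + d i * (- y * c (fintype.lift i j))).
  rewrite (bigD1_ord i) //= gi scaler_sumr addrC -big_split.
  by apply: eq_bigr => j _; rewrite /= scalerDl scalerA.
exists (fun j => if unlift i j is Some j' then d j' else 0).
rewrite (bigD1_ord i) //= unlift_none scale0r add0r.
by apply: eq_bigr => j _; rewrite liftK.
Qed.

Lemma noeth_free b (P : set 'rV[R]_b) :
  P 0 -> (forall a u v, P u -> P v -> P (a *: u + v)) ->
  exists k (g : 'I_k -> 'rV_b), generates P g.
Proof.
elim: b P => [|b IHb] P P0 PD.
  exists 0, (fun=> 0) => v; rewrite (thinmx0 v).
  by split=> // _; exists (fun=> 0); rewrite big_ord0.
have PZ a u : P u -> P (a *: u) by move=> Pu; rewrite -[_ *: _]addr0; apply: PD.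
have Psum k (c : 'I_k -> R) (g : 'I_k -> 'rV_b.+1) :
    (forall i, P (g i)) -> P (\sum_i c i *: g i).
  by move=> Pg; elim/big_ind: _ => // [u v Pu Pv|i _]; [rewrite -[u]scale1r; exact: PD|exact: PZ].
pose I : set R := [set x | exists2 u, P u & u 0 0 = x].
have noethI : ideal I -> fg_ideal I by exact: noetherian.
have [|k [g gI]] := noethI.
  split=> [|a _ _ [u Pu <-] [v Pv <-]]; first by exists 0; rewrite ?mxE.
  by exists (a *: u + v); [exact: PD|rewrite !mxE].
have /choice[G GP] : forall i, exists u, P u /\ u 0 0 = g i.
  move=> i; have [|u Pu ui] := (gI (g i)).2; last by exists u.
  exists (fun j => (j == i)%:R); rewrite (bigD1 i) //= eqxx mul1r big1 ?addr0 //.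
  by move=> j /negbTE ->; rewrite mul0r.
have row0E (u : 'rV[R]_b.+1) : u 0 0 = 0 -> u = row_mx (0 : 'rV_1) (rsubmx (u : 'rV_(1 + b))).
  move=> u0; rewrite -[LHS](@hsubmxK _ 1 1 b) /=; congr (row_mx (_ : 'rV_1) _).
  apply/rowP => i; rewrite !mxE ord1 -[RHS]u0; congr (u _ _); exact: val_inj.
have [||k' [g' g'P]] := IHb [set v | P (row_mx (0 : 'rV_1) v)].
- by rewrite /= row_mx0.
- move=> a u v /= Pu Pv.
  have -> : row_mx (0 : 'rV_1) (a *: u + v) = a *: row_mx 0 u + row_mx 0 v.
    by rewrite scale_row_mx add_row_mx scaler0 addr0.
  exact: PD.
exists (k + k')%N, (fun i => match fintype.split i with
  inl i => G i | inr i => row_mx (0 : 'rV_1) (g' i) end) => v; split; last first.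
  move=> [c ->]; apply: Psum => i; case: fintype.split => j; first by have [] := GP j.
  by apply/(g'P (g' j)); exists (fun l => (l == j)%:R);
    rewrite (bigD1 j) //= eqxx scale1r big1 ?addr0 // => l /negbTE ->; rewrite scale0r.
move=> Pv; have [|c vc] := (gI (v 0 0)).1; first by exists v.
pose w := v - \sum_i c i *: G i.
have Pw : P w.
  by rewrite /w addrC -scaleN1r; apply: PD => //; apply: Psum => i; have [] := GP i.
have w0 : w 0 0 = 0.
  rewrite !mxE summxE vc; apply/eqP; rewrite subr_eq0; apply/eqP/eq_bigr => i _.
  by rewrite mxE (GP i).2.
have /g'P[d wd] : [set v | P (row_mx (0 : 'rV_1) v)] (rsubmx (w : 'rV_(1 + b))).
  by rewrite /= -row0E.
exists (fun i => match fintype.split i with inl i => c i | inr i => d i end).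
rewrite big_split_ord /=; under eq_bigr do rewrite (unsplitK (inl _ _)).
under [X in _ + X]eq_bigr do rewrite (unsplitK (inr _ _)).
rewrite -(subrK (\sum_i c i *: G i) v) addrC -/w; congr (_ + _).
rewrite (row0E _ w0) wd.
apply: (big_ind2 (fun u v => row_mx (0 : 'rV_1) u = v)) => [|u ? u' ? <- <-|i _].
- by rewrite row_mx0.
- by apply: esym; etransitivity; [exact: add_row_mx|rewrite addr0].
- by apply: esym; etransitivity; [exact: scale_row_mx|rewrite scaler0].
Qed.

Lemma minimal_syzygy p q (A : 'M[R]_(p, q)) :
  exists p' (B : 'M[R]_(p', p)),
    (forall u : 'rV_p, u *m A = 0 <-> exists w, u = w *m B) /\
    (forall w : 'rV_p', w *m B = 0 -> forall i, maxid (w 0 i)).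
Proof.
have [||k [g /minimal_generators[p' [g' [g'P g'm]]]]] :=
  @noeth_free p [set u | u *m A = 0].
- by rewrite /= mul0mx.
- by move=> a u v /= u0 v0; rewrite mulmxDl -scalemxAl u0 v0 scaler0 addr0.
have mulE (w : 'rV_p') : w *m \matrix_i g' i = \sum_i w 0 i *: g' i.
  by rewrite mulmx_sum_row; apply: eq_bigr => i _; rewrite rowK.
exists p', (\matrix_i g' i); split=> [u|w]; last by rewrite mulE => /g'm.
apply: iff_trans (g'P u) _; split=> [[c ->]|[w ->]]; last by exists (w 0).
by exists (\row_i c i); rewrite mulE; apply: eq_bigr => i _; rewrite mxE.
Qed.

Lemma minimal_free_resolution_exists (X : lmodType R) :
  finitely_generated X -> exists F, minimal_free_resolution X F.
Proof.
move=> [k [g gX]].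
have [|b [h [hX hm]]] := @minimal_generators X setT k g; first by split.
pose e (u : 'rV[R]_b) := \sum_i u 0 i *: h i.
have e_lin : linear e.
  move=> a u v; rewrite /e scaler_sumr -big_split /=; apply: eq_bigr => i _.
  by rewrite !mxE scalerDl scalerA.
pose E := GRing.isLinear.Build R _ _ _ e e_lin.
pose eL : {linear 'rV[R]_b -> X} := HB.pack e E.
have [k0 [g0 g0P]] : exists k0 (g0 : 'I_k0 -> 'rV_b), generates [set u | e u = 0] g0.
  apply: noeth_free => [|a u v /= u0 v0]; first exact: (raddf0 eL).
  by rewrite e_lin u0 v0 scaler0 addr0.
have [b1 [h1 [h1P h1m]]] := minimal_generators g0P.
have mulE (w : 'rV_b1) : w *m \matrix_i h1 i = \sum_i w 0 i *: h1 i.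
  by rewrite mulmx_sum_row; apply: eq_bigr => i _; rewrite rowK.
pose A0 := \matrix_i h1 i.
have A0P u : e u = 0 <-> exists w, u = w *m A0.
  apply: iff_trans (h1P u) _; split=> [[c ->]|[w ->]]; last by exists (w 0).
  by exists (\row_i c i); rewrite mulE; apply: eq_bigr => i _; rewrite mxE.
pose T := {p : nat & {q : nat & 'M[R]_(p, q)}}.
pose next_rk (p q : nat) (A : 'M_(p, q)) := projT1 (cid (minimal_syzygy A)).
pose next (p q : nat) (A : 'M_(p, q)) : 'M_(next_rk p q A, p) :=
  projT1 (cid (projT2 (cid (minimal_syzygy A)))).
have nextP p q (A : 'M_(p, q)) := projT2 (cid (projT2 (cid (minimal_syzygy A)))).
pose fix st (n : nat) : T :=
  if n is n'.+1 then
    let t := st n' in existT _ _ (existT _ _ (next _ _ (projT2 (projT2 t))))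
  else existT _ _ (existT _ _ A0).
pose rkF (n : nat) := if n is n'.+1 then projT1 (st n') else b.
pose difF (n : nat) : 'M[R]_(rkF n.+1, rkF n) :=
  match n return 'M[R]_(rkF n.+1, rkF n) with
  | 0 => A0
  | n'.+1 => next _ _ (projT2 (projT2 (st n')))
  end.
have exactF n (u : 'rV_(rkF n.+1)) :
    u *m difF n = 0 <-> exists w, u = w *m difF n.+1.
  by case: n u => [|n] u; [exact: (nextP _ _ A0).1|exact: (nextP _ _ (difF n.+1)).1].
have minF n (w : 'rV_(rkF n.+1)) : w *m difF n = 0 -> forall i, maxid (w 0 i).
  case: n w => [|n] w; first by rewrite mulE; exact: h1m.
  by case: n w => [|n] w; [exact: (nextP _ _ A0).2|exact: (nextP _ _ (difF n.+1)).2].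
have difK n : difF n.+1 *m difF n = 0.
  apply/row_matrixP => i; rewrite row_mul row0; apply/exactF.
  by exists (delta_mx 0 i); rewrite -rowE.
exists (FreeComplex difK); split.
  exists eL; split=> [v||n u]; [|exact: A0P|exact: exactF].
  by have [|c ->] := (hX v).1; [|exists (\row_i c i); apply: eq_bigr => i _; rewrite mxE].
case=> [|n] i j /=.
  have /hm/(_ j) : e (row i A0) = 0 by apply/A0P; exists (delta_mx 0 i); rewrite -rowE.
  by rewrite mxE.
have : row i (difF n.+1) *m difF n = 0 by rewrite -row_mul difK row0.
by move=> /minF/(_ j); rewrite mxE.
Qed.

Lemma min_resP (X : lmodType R) :
  finitely_generated X -> minimal_free_resolution X (min_res X).
Proof. by move=> /minimal_free_resolution_exists; exact: xgetPex. Qed.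

Lemma wgdP (X : lmodType R) : is_wgd X (wgd X).
Proof.
apply: xgetPex.
set A := [set i : nat | (0 < i)%N /\ ~ trivial (Ext i X R^o)].
have [inf|/contrapT/finite_seqP[s As]] := pselect (infinite_set A).
  by exists +oo%E; apply: Or33.
have Amax i : `[< A i >] -> (i <= \max_(j <- s) j)%N.
  by move=> /asboolP; rewrite As /= => si; rewrite (big_rem i) //= leq_maxl.
have [exA|nA] := pselect (exists i, `[< A i >]); last first.
  exists 0%E; apply: Or31; split=> // i i0; apply: contrapT => Exti.
  by apply: nA; exists i; apply/asboolP.
case: (ex_maxnP exA Amax) => t /asboolP[t0 Extt] tmax.
exists t%:R%:E; apply: Or32; exists t; split=> // i ti.
apply: contrapT => Exti; suff: (i <= t)%N by rewrite leqNgt ti.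
by apply/tmax/asboolP; split=> //; apply: leq_ltn_trans ti.
Qed.

End MinimalResolution.

(* Main.v *)
(* Write F for the minimal free resolution of M and n = w.g.d(M). The dual
   complex G = Hom(F, R) is exact above degree n, and Ext^i(M, X) is the
   cohomology of G (x) X. Extending the exact part of G to the left by free
   modules gives an exact complex T of free modules with the same homology as
   Ext(M, -) above n. Over the reducing sequence
     0 -> X -> K_eta -> Omega^q X -> 0,  |eta| = q + 1,
   vanishing of the homology of T (x) K_eta makes that of T (x) X periodic, so
   eventual vanishing forces T (x) N to be exact. Exactness of T (x) N at the
   two extra terms says that Ext^n(M, R) (x) N -> Ext^n(M, N) is bijective, and the
   left side is nonzero by Nakayama. For n = 0 one also needs Hom(M, R) <> 0:
   otherwise G would be a bounded below exact minimal complex, which the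
   finiteness of the depth of R, in the form of a nonzero Koszul homology
   module, excludes. *)
From HB Require Import structures.
Require Import Defs.
From mathcomp Require Import all_boot all_order all_algebra.
From mathcomp Require Import all_classical all_reals ereal Rstruct.
From mathcomp.multinomials Require Import freeg.
Set Implicit Arguments.
Unset Strict Implicit.
Unset Printing Implicit Defensive.
Import Order.TTheory GRing.Theory Num.Theory.
Local Open Scope classical_set_scope.
Local Open Scope ring_scope.

(** * Exactness of dual complexes of free modules and change of coefficients *)

Section Exactness.
Variable R : comNzRingType.
Implicit Types U V W X Y : lmodType R.

Lemma hom_difE p q (A : 'M[R]_(p, q)) Y (phi : {ffun 'I_q -> Y}) i :
  hom_dif A Y phi i = \sum_j A i j *: phi j.
Proof. by rewrite ffunE. Qed.

Lemma hom_dif_mul r p q (B : 'M[R]_(r, p)) (A : 'M[R]_(p, q)) Y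
    (phi : {ffun 'I_q -> Y}) :
  hom_dif B Y (hom_dif A Y phi) = hom_dif (B *m A) Y phi.
Proof.
apply/ffunP => i; rewrite !hom_difE.
under eq_bigr do rewrite hom_difE scaler_sumr.
rewrite exchange_big; apply: eq_bigr => j _; rewrite mxE scaler_suml.
by apply: eq_bigr => l _; rewrite scalerA.
Qed.

Lemma hom_dif0 p q Y (phi : {ffun 'I_q -> Y}) :
  hom_dif (0 : 'M[R]_(p, q)) Y phi = 0.
Proof.
apply/ffunP => i; rewrite hom_difE ffunE big1 // => j _.
by rewrite mxE scale0r.
Qed.

Definition ffmap q U V (f : U -> V) (phi : {ffun 'I_q -> U}) : {ffun 'I_q -> V} :=
  [ffun i => f (phi i)].

Lemma hom_dif_ffmap p q (A : 'M[R]_(p, q)) U V (f : {linear U -> V}) phi :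
  hom_dif A V (ffmap f phi) = ffmap f (hom_dif A U phi).
Proof.
apply/ffunP => i; rewrite hom_difE !ffunE linear_sum.
by apply: eq_bigr => j _; rewrite ffunE linearZ.
Qed.

Lemma ffmapB q U V (f : {linear U -> V}) (phi psi : {ffun 'I_q -> U}) :
  ffmap f (phi - psi) = ffmap f phi - ffmap f psi.
Proof. by apply/ffunP => i; rewrite !ffunE raddfB. Qed.

Lemma ffmap0 q U V (f : {linear U -> V}) : ffmap f (0 : {ffun 'I_q -> U}) = 0.
Proof. by apply/ffunP => i; rewrite !ffunE raddf0. Qed.

Lemma ffmap_surj q U V (f : U -> V) (psi : {ffun 'I_q -> V}) :
  (forall v, exists u, f u = v) -> exists phi, ffmap f phi = psi.
Proof.
move=> fS; have /choice[g gP] : forall i, exists u, f u = psi i by move=> i.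
by exists [ffun i => g i]; apply/ffunP => i; rewrite !ffunE.
Qed.

Lemma ffmap_inj q U V (f : U -> V) : injective f -> injective (@ffmap q U V f).
Proof. by move=> fI phi psi /ffunP e; apply/ffunP => i; have := e i; rewrite !ffunE => /fI. Qed.

Definition short_exact U V W (i : {linear U -> V}) (p : {linear V -> W}) : Prop :=
  [/\ injective i, forall w, exists v, p v = w &
      forall v, p v = 0 <-> exists u, i u = v].

(** One half of exactness at [Y^p] in [Y^q -> Y^p -> Y^r]; the other half follows from [B *m A = 0],
    carried separately. *)
Definition exact_at r p q (B : 'M[R]_(r, p)) (A : 'M[R]_(p, q)) Y : Prop :=
  forall phi, hom_dif B Y phi = 0 -> exists psi, hom_dif A Y psi = phi.

Section LongExactSequence.
Variables (U V W : lmodType R) (i : {linear U -> V}) (p : {linear V -> W}).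
Hypothesis ip : short_exact i p.

Lemma ffmap_ker q (phi : {ffun 'I_q -> V}) :
  ffmap p phi = 0 -> exists chi, ffmap i chi = phi.
Proof.
move=> /ffunP p0; have [_ _ pi] := ip.
have /choice[g gP] : forall j, exists u, i u = phi j.
  by move=> j; apply/pi; have := p0 j; rewrite !ffunE.
by exists [ffun j => g j]; apply/ffunP => j; rewrite !ffunE.
Qed.

Lemma ffmap_comp0 q (chi : {ffun 'I_q -> U}) : ffmap p (ffmap i chi) = 0.
Proof.
have [_ _ pi] := ip; apply/ffunP => j; rewrite !ffunE.
by apply/pi; exists (chi j).
Qed.

Variables (n0 n1 n2 n3 : nat).
Variables (A : 'M[R]_(n1, n0)) (B : 'M[R]_(n2, n1)) (C : 'M[R]_(n3, n2)).
Hypotheses (BA : B *m A = 0) (CB : C *m B = 0).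

(** Snake argument: a lift of a cycle of [W] has its boundary in [U], one index higher; exactness
    there gives a correction from [U] that turns the lift into a cycle of [V]. *)
Lemma exact_quotient : exact_at B A V -> exact_at C B U -> exact_at B A W.
Proof.
have [iI pS _] := ip; move=> exV exU w; have [phi <-] := ffmap_surj w pS.
rewrite hom_dif_ffmap => /ffmap_ker[chi chiE].
have [|om omE] := exU chi.
  apply: (ffmap_inj iI); rewrite -hom_dif_ffmap chiE hom_dif_mul CB hom_dif0.
  by rewrite ffmap0.
have [|psi psiE] := exV (phi - ffmap i om).
  by rewrite raddfB /= hom_dif_ffmap omE chiE subrr.
exists (ffmap p psi); rewrite hom_dif_ffmap psiE ffmapB ffmap_comp0.
by rewrite subr0.
Qed.

(** A cycle of [U] is the boundary of some [phi] over [V], whose image over [W] is a boundary;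
    subtracting the boundary of a lift moves [phi] into [U]. *)
Lemma exact_sub : exact_at B A W -> exact_at C B V -> exact_at C B U.
Proof.
have [iI pS _] := ip; move=> exW exV chi chi0.
have [|phi phiE] := exV (ffmap i chi).
  by rewrite hom_dif_ffmap chi0 ffmap0.
have [|psi] := exW (ffmap p phi).
  by rewrite hom_dif_ffmap phiE ffmap_comp0.
have [psi' <-] := ffmap_surj psi pS.
rewrite hom_dif_ffmap => /eqP; rewrite eq_sym -subr_eq0 -ffmapB => /eqP.
move=> /ffmap_ker[om omE]; exists om; apply: (ffmap_inj iI).
rewrite -hom_dif_ffmap omE raddfB /= phiE hom_dif_mul BA hom_dif0.
by rewrite subr0.
Qed.

Lemma exact_extension : exact_at B A U -> exact_at B A W -> exact_at B A V.
Proof.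
have [iI pS _] := ip; move=> exU exW phi phi0.
have [|psi] := exW (ffmap p phi).
  by rewrite hom_dif_ffmap phi0 ffmap0.
have [psi' <-] := ffmap_surj psi pS.
rewrite hom_dif_ffmap => /eqP; rewrite eq_sym -subr_eq0 -ffmapB => /eqP.
move=> /ffmap_ker[om omE]; have [|tau tauE] := exU om.
  apply: (ffmap_inj iI); rewrite -hom_dif_ffmap omE raddfB /= phi0.
  by rewrite hom_dif_mul BA hom_dif0 subr0 ffmap0.
exists (psi' + ffmap i tau).
by rewrite raddfD /= hom_dif_ffmap tauE omE addrC subrK.
Qed.

End LongExactSequence.

Section ExactAt.
Variables (n0 n1 n2 : nat) (A : 'M[R]_(n1, n0)) (B : 'M[R]_(n2, n1)).

Lemma exact_retract V W (s : {linear W -> V}) (p : {linear V -> W}) :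
  cancel s p -> exact_at B A V -> exact_at B A W.
Proof.
move=> sK exV w w0; have [|psi psiE] := exV (ffmap s w).
  by rewrite hom_dif_ffmap w0 ffmap0.
exists (ffmap p psi); rewrite hom_dif_ffmap psiE.
by apply/ffunP => j; rewrite !ffunE sK.
Qed.

Lemma exact_trivial V : trivial V -> exact_at B A V.
Proof. by move=> V0 phi _; exists 0; apply/ffunP => j; exact: (etrans (V0 _) (esym (V0 _))). Qed.

Hypothesis exR : exact_at B A R^o.

Lemma exact_rV m : exact_at B A 'rV[R]_m.
Proof.
move=> phi phi0.
have /choice[psi psiE] : forall l : 'I_m, exists psi : {ffun 'I_n0 -> R^o},
    hom_dif A R^o psi = [ffun j => phi j 0 l].
  move=> l; apply: exR; apply/ffunP => j; rewrite hom_difE ffunE.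
  have /ffunP/(_ j) := phi0; rewrite hom_difE ffunE => /rowP/(_ l).
  rewrite summxE mxE; apply: etrans; apply: eq_bigr => k _.
  by rewrite ffunE [RHS]mxE.
exists [ffun j => \row_l psi l j]; apply/ffunP => j; apply/rowP => l.
have /ffunP/(_ j) := psiE l; rewrite !hom_difE ffunE => <-.
by rewrite summxE; apply: eq_bigr => k _; rewrite ffunE !mxE.
Qed.

End ExactAt.

Lemma linear_pack U V (f : U -> V) :
  linear f -> exists g : {linear U -> V}, g =1 f.
Proof.
move=> f_lin; pose E := GRing.isLinear.Build R U V *:%R f f_lin.
pose g : {linear U -> V} := HB.pack f E; by exists g.
Qed.

Lemma fg_cover V : finitely_generated V ->
  exists k (g : {linear 'rV[R]_k -> V}), forall v, exists u, g u = v.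
Proof.
move=> [k [g gV]]; pose e (u : 'rV[R]_k) := \sum_i u 0 i *: g i.
have [|eL eLE] := @linear_pack _ _ e.
  move=> a u v; rewrite /e scaler_sumr -big_split /=; apply: eq_bigr => i _.
  by rewrite !mxE scalerDl scalerA.
exists k, eL => v; have [c ->] := gV v; exists (\row_i c i).
by rewrite eLE; apply: eq_bigr => i _; rewrite mxE.
Qed.

(** The module is a retract of some [R^k], where exactness is checked coordinate by coordinate. *)
Lemma exact_projective n0 n1 n2 (A : 'M[R]_(n1, n0)) (B : 'M[R]_(n2, n1)) V :
  exact_at B A R^o -> projective V -> finitely_generated V -> exact_at B A V.
Proof.
move=> exR pV /fg_cover[k [g gS]].
have [s sK] := pV _ _ g (idfun : {linear V -> V}) gS.
have sK' : cancel s g by move=> v; rewrite sK.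
exact: exact_retract sK' (exact_rV exR (m := k)).
Qed.

Lemma linear_quotmod V W (S : {pred V}) (S_submod : submod_closed S)
    (f : {linear V -> W}) : (forall v, v \in S -> f v = 0) ->
  exists g : {linear quotmod S_submod -> W}, forall v, g (quotpi S_submod v) = f v.
Proof.
move=> fS; pose g (x : quotmod S_submod) := f (quotrepr x).
have gE v : g (quotpi S_submod v) = f v.
  apply/eqP; rewrite -subr_eq0 -raddfB; apply/eqP/fS.
  by apply/(quotpi_eq S_submod); rewrite quotreprK.
have [|h hE] := @linear_pack _ _ g.
  move=> a x y; rewrite -(quotreprK x) -(quotreprK y) -linearP !gE.
  by rewrite linearP.
by exists h => v; rewrite hE.
Qed.

End Exactness.

(** * Coefficients of finite projective dimension *)

Section Resolutions.
Variable R : comNzRingType.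
Implicit Types U V W X Y : lmodType R.

Lemma linear_kermod U V W (g : {linear V -> W}) (f : {linear U -> V}) :
  (forall u, g (f u) = 0) ->
  exists h : {linear U -> kermod g}, forall u, val (h u) = f u.
Proof.
move=> gf; have fK u : f u \in ker g by apply/eqP/gf.
have [|h hE] := @linear_pack R U (kermod g) (fun u => Sub (f u) (fK u)).
  by move=> a u v; apply: val_inj; rewrite [RHS]linearP !SubK linearP.
by exists h => u; rewrite hE SubK.
Qed.

Lemma short_exact_kermod V W (g : {linear V -> W}) :
  (forall w, exists v, g v = w) ->
  short_exact (val : {linear kermod g -> V}) g.
Proof.
move=> gS; split=> // v; split=> [/eqP gv|[u <-]]; last by apply/eqP; exact: (valP u).
by exists (Sub v gv : kermod g).
Qed.

Lemma short_exact_bij V W (g : {linear V -> W}) :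
  injective g -> (forall w, exists v, g v = w) ->
  short_exact (\0 : {linear 'rV[R]_0 -> V}) g.
Proof.
move=> gI gS; split=> // [u v _|v]; first by rewrite (thinmx0 u) (thinmx0 v).
split=> [gv|[u <-]]; last by rewrite raddf0.
by exists 0; apply: gI; rewrite gv raddf0.
Qed.

Lemma trivial_rV0 : trivial 'rV[R]_0.
Proof. by move=> u; rewrite (thinmx0 u). Qed.

Section Acyclic.
Variables (T : free_complex R).

(** Index [k] concerns the term of rank [rk T k.+1]; nothing is required at the first term, of rank
    [rk T 0]. *)
Definition exact_dif k X := exact_at (dif T k.+1) (dif T k) X.

Hypothesis exT : forall k, exact_dif k R^o.

(** Induction on the length: the kernel of [e] is resolved by the remaining [P n], and exactness for
    [V] at [j] follows from [P 0] at [j] and the kernel at [j.+1]. *)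
Lemma exact_resolution k V (P : nat -> lmodType R)
    (d : forall n, {linear P n.+1 -> P n}) (e : {linear P 0%N -> V}) :
  (forall n, projective (P n) /\ finitely_generated (P n)) ->
  (forall n, (k <= n)%N -> trivial (P n)) ->
  (forall v, exists u, e u = v) ->
  (forall u, e u = 0 <-> exists w, u = d 0%N w) ->
  (forall n u, d n u = 0 <-> exists w, u = d n.+1 w) ->
  forall j, exact_dif j V.
Proof.
elim: k V P d e => [|k IHk] V P d e Pproj P0 eS eE dE j.
  apply: exact_trivial => v; have [u <-] := eS v.
  by rewrite (P0 0%N _ u) // raddf0.
have [|d0 d0E] := @linear_kermod _ _ _ e (d 0%N).
  by move=> u; apply/eE; exists u.
apply: (exact_quotient (short_exact_kermod eS) (dif_dif _ _)).
  by have [pP fP] := Pproj 0%N; exact: (exact_projective (@exT j) pP fP).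
apply: (IHk _ (fun n => P n.+1) (fun n => d n.+1) d0).
- by move=> n; exact: Pproj.
- by move=> n kn; exact: P0.
- move=> v; have /eE[w vE] : e (val v) = 0 by apply/eqP; exact: (valP v).
  by exists w; apply: val_inj; rewrite d0E.
- move=> u; rewrite -dE -d0E; split=> [->|u0]; first by rewrite raddf0.
  by apply: val_inj; rewrite u0 raddf0.
- by move=> n u; exact: dE.
Qed.

Lemma exact_finite_pd V : finite_projective_dimension V ->
  forall j, exact_dif j V.
Proof.
move=> [P [d [e [k [Pproj P0 eS eE dE]]]]].
(* [finite_projective_dimension] makes [P n] trivial for [k < n], whereas [exact_resolution] counts
   from [k <= n]. *)
exact: (@exact_resolution k.+1 V P d e).
Qed.

End Acyclic.
End Resolutions.

(** * Syzygies, the pushout module and reducible complexity *)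

Section Reducible.
Variable R : noethLocalRingType.
Implicit Types M N X Y : lmodType R.

Lemma syzygy_incl_inj q X : finitely_generated X ->
  injective (@syzygy_incl R q X).
Proof.
move=> /min_resP[[_ [_ _ resX]] _] u v uv; apply/eqP; rewrite -subr_eq0.
move: uv => /eqP; rewrite -subr_eq0 -raddfB /=; move: (u - v) => {u v} w.
rewrite -(quotreprK w) -/(syzygy_pi _) syzygy_inclE => /eqP/resX[x xE].
rewrite -(raddf0 (@quotpi R _ _ _)); apply/eqP/quotpi_eq.
by rewrite subr0; apply/asboolP; exists x; rewrite xE.
Qed.

Lemma syzygy_pi_eq0 q X u : (@syzygy_pi R q X u) = 0 <->
  exists w, u = w *m dif (min_res X) q.
Proof.
rewrite -(raddf0 (@quotpi R _ _ _)) quotpi_eq subr0.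
by split=> [/asboolP[w <-]|[w ->]]; [exists w|apply/asboolP; exists w].
Qed.

Lemma syzygy_pi_surj q X x : exists u, @syzygy_pi R q X u = x.
Proof. by exists (quotrepr x); exact: quotreprK. Qed.

Definition syzygy_piL q X : {linear 'rV[R]_(betti X q) -> syzygy q X} :=
  quotpi _.

Lemma syzygy_piL_incl q X w : syzygy_piL q X (syzygy_incl w) = 0.
Proof.
rewrite -(quotreprK w) -/(syzygy_pi _) syzygy_inclE.
by apply/syzygy_pi_eq0; exists (quotrepr w).
Qed.

Lemma syzygy_piL_eq0 q X u : syzygy_piL q X u = 0 <->
  exists w, syzygy_incl w = u.
Proof.
split=> [/syzygy_pi_eq0[w ->]|[w <-]]; last exact: syzygy_piL_incl.
by exists (syzygy_pi w); rewrite syzygy_inclE.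
Qed.

Lemma short_exact_syzygy q X : finitely_generated X ->
  short_exact (@syzygy_incl R q X : {linear _ -> _}) (syzygy_piL q X).
Proof.
move=> Xfg; split; [exact: syzygy_incl_inj|exact: syzygy_pi_surj|].
exact: syzygy_piL_eq0.
Qed.

Lemma syzygy0_iso X : finitely_generated X ->
  exists g : {linear syzygy 0 X -> X}, injective g /\ forall x, exists u, g u = x.
Proof.
move=> /min_resP[[e [eS eE _]] _].
have [|g gE] := @linear_quotmod R _ _ _ (img_submod
    (mulmxr (dif (min_res X) 0) : {linear 'rV_(betti X 1) -> 'rV_(betti X 0)})) e.
  by move=> u /asboolP[w <-]; apply/eE; exists w.
exists g; split=> [u v|x]; last first.
  by have [u <-] := eS x; exists (quotpi _ u).
rewrite -[u]quotreprK -[v]quotreprK !gE => /eqP; rewrite -subr_eq0 -raddfB.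
by move=> /eqP/eE[w wE]; apply/quotpi_eq/asboolP; exists w.
Qed.

(** A pushout keeps the cokernel of the inclusion of [Omega^(q+1) X] in [F_q], which is [Omega^q X];
    [Y] embeds because that inclusion is injective. *)
Lemma short_exact_Kmod q X Y (f : {linear syzygy q.+1 X -> Y}) :
  finitely_generated X ->
  exists (i : {linear Y -> Kmod f}) (p : {linear Kmod f -> syzygy q X}),
    short_exact i p.
Proof.
move=> Xfg.
pose rel : {linear syzygy q.+1 X -> (Y * 'rV[R]_(betti X q))%type} :=
  pushout_rel f (@syzygy_incl R q X).
have pE y u : quotpi (img_submod rel) (y, u) = 0 <->
    exists w, f w = y /\ - syzygy_incl w = u.
  rewrite -(raddf0 (@quotpi R _ _ _)) quotpi_eq subr0.
  by split=> [/asboolP[w [<- <-]]|[w [<- <-]]]; [exists w|apply/asboolP; exists w].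
have [|i iE] := @linear_pack R Y (Kmod f) (fun y => quotpi (img_submod rel) (y, 0)).
  by move=> a y z; rewrite -linearP; congr quotpi; congr (_, _); rewrite /= scaler0 addr0.
have [|s sE] := @linear_pack R (Y * 'rV[R]_(betti X q))%type (syzygy q X)
    (fun yu => syzygy_piL q X yu.2).
  by move=> a y z; rewrite -linearP.
have [|p pP] := @linear_quotmod R _ _ _ (img_submod rel) s.
  move=> v /asboolP[w <-]; rewrite sE; apply/syzygy_piL_eq0; exists (- w).
  exact: raddfN.
exists i, p; split.
- move=> y z /eqP; rewrite -subr_eq0 -raddfB /= iE => /eqP/pE[w [wyz /eqP]].
  rewrite oppr_eq0 -(raddf0 (@syzygy_incl R q X)) => /eqP/(syzygy_incl_inj Xfg) w0.
  by apply/eqP; rewrite -subr_eq0 -wyz w0 raddf0.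
- move=> x; have [u <-] := syzygy_pi_surj x.
  by exists (quotpi (img_submod rel) (0, u)); rewrite pP sE.
move=> v; split=> [|[y <-]]; last by rewrite iE pP sE raddf0.
rewrite -[v]quotreprK; case: (quotrepr v) => y u.
rewrite pP sE => /syzygy_piL_eq0[w wu].
(* Here [u = syzygy_incl w], so [(y, u)] and [(y + f w, 0)] differ by the relation
   [(f w, - syzygy_incl w)]. *)
exists (y + f w); rewrite iE; apply/eqP; rewrite -subr_eq0 -raddfB /=; apply/eqP.
apply/pE; exists w; split; first by rewrite addrC addKr.
by rewrite sub0r wu.
Qed.

Variable T : free_complex R.
Hypothesis exT : forall k, exact_dif T k R^o.

(** Dimension shifting: in [0 -> Omega^(q+1) X -> F_q -> Omega^q X -> 0] the middle term is free, so
    exactness for it holds at every index. *)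
Lemma exact_syzygyS q X k : finitely_generated X ->
  exact_dif T k (syzygy q X) <-> exact_dif T k.+1 (syzygy q.+1 X).
Proof.
move=> /(short_exact_syzygy q) se; split=> ex.
  exact: (exact_sub se (dif_dif _ _) ex (exact_rV (@exT _) (m := _))).
exact: (exact_quotient se (dif_dif _ _) (exact_rV (@exT _) (m := _)) ex).
Qed.

Lemma exact_syzygy q X k : finitely_generated X ->
  exact_dif T k X <-> exact_dif T (q + k) (syzygy q X).
Proof.
move=> Xfg; elim: q => [|q IHq]; last by rewrite IHq; exact: exact_syzygyS.
have [g [gI gS]] := syzygy0_iso Xfg.
have se := short_exact_bij gI gS.
have ex0 j : exact_dif T j 'rV[R]_0 by apply: exact_trivial; exact: trivial_rV0.
split=> ex.
  exact: (exact_extension se (dif_dif _ _) (@ex0 _) ex).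
exact: (exact_quotient se (dif_dif _ _) ex (@ex0 _)).
Qed.

(* The connecting maps shift degrees by one and syzygies by q, so the vanishing
   of the homology of K_eta makes the homology of N periodic of period q + 1. *)
Lemma exact_reducible N : reducible_complexity N ->
  (exists k0, forall k, (k0 <= k)%N -> exact_dif T k N) ->
  forall k, exact_dif T k N.
Proof.
elim=> {N} [X _ pdX _|X q _ f Xfg _ _ _ _ _ _ IH [k0 exX]].
  exact: exact_finite_pd.
have [i [p se]] := short_exact_Kmod f Xfg.
(* [Kmod f] is an extension of [Omega^q X] by [X], and [Omega^q X] at [k] behaves like [X] at
   [k - q]; both outer terms are thus exact from [q + k0] on. *)
have exK : forall k, exact_dif T k (Kmod f).
  apply: IH; exists (q + k0)%N => k qk; have k0k := leq_trans (leq_addl _ _) qk.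
  apply: (exact_extension se (dif_dif _ _) (exX _ k0k)).
  rewrite -/(exact_dif _ _ _) -(subnKC (leq_trans (leq_addr _ _) qk)).
  apply/(exact_syzygy q (k - q) Xfg); apply: exX.
  by rewrite leq_subRL // (leq_trans (leq_addr _ _) qk).
(* [Kmod f] at [q + k] and [X] at [q + k + 1] give [Omega^q X] at [q + k], that is, [X] at [k]. *)
have per k : exact_dif T (q.+1 + k) X -> exact_dif T k X.
  move=> ex; apply/(exact_syzygy q k Xfg).
  exact: (exact_quotient se (dif_dif _ _) (exK _) ex).
move=> k; have : exact_dif T (k0 * q.+1 + k) X.
  by apply: exX; rewrite (leq_trans _ (leq_addr _ _)) // leq_pmulr.
by elim: k0 {exX} => [//|m IHm]; rewrite mulSn -addnA => /per.
Qed.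

End Reducible.

(** * Mapping cones of multiplication by a ring element *)

Section Cone.
Variable R : comNzRingType.
Variables (C : nat -> lmodType R) (d : forall n, {linear C n.+1 -> C n}).

(** [h] is a homotopy from multiplication by [y] to zero; in degree 0 there is no term [h d]. Such a
    [y] annihilates the homology. *)
Definition null_homotopic (y : R) : Prop :=
  exists h : forall n, C n -> C n.+1,
    [/\ forall n, linear (h n), forall a, d 0%N (h 0%N a) = y *: a &
        forall n a, d n.+1 (h n.+1 a) + h n (d n a) = y *: a].

Lemma null_homotopic_cycle0 y (z : C 0%N) : null_homotopic y ->
  exists w, d 0%N w = y *: z.
Proof. by case=> h [_ h0 _]; exists (h 0%N z). Qed.

Lemma null_homotopic_cycle y n (z : C n.+1) : null_homotopic y ->
  d n z = 0 -> exists w, d n.+1 w = y *: z.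
Proof.
case=> h [hL _ hS] dz; exists (h n.+1 z); rewrite -hS dz.
have [g gE] := linear_pack (hL n).
by rewrite -gE raddf0 addr0.
Qed.

Variable x : R.

Definition cone n : lmodType R :=
  if n is m.+1 then (C m.+1 * C m)%type : lmodType R else C 0%N.

Definition cone_dif n : cone n.+1 -> cone n :=
  match n return cone n.+1 -> cone n with
  | 0 => fun ab => d 0%N ab.1 + x *: ab.2
  | m.+1 => fun ab => (d m.+1 ab.1 + x *: ab.2, - d m ab.2)
  end.

Lemma cone_dif_linear n : linear (@cone_dif n).
Proof.
have xE m k (u v : C k) (u' v' : C m) (f : {linear C k -> C m}) a :
    f (a *: u + v) + x *: (a *: u' + v') = a *: (f u + x *: u') + (f v + x *: v').
  by rewrite linearP !scalerDr !scalerA mulrC addrACA.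
case: n => [|n] a [u u'] [v v']; rewrite /cone_dif /=; first exact: xE.
by congr (_, _); rewrite /= ?xE // linearP opprD scalerN.
Qed.

Lemma cone_dif_dif : (forall n a, d n (d n.+1 a) = 0) ->
  forall n a, cone_dif (@cone_dif n.+1 a) = 0.
Proof.
move=> dd [|n] [u v]; rewrite /cone_dif /=; last congr (_, _).
- by rewrite raddfD /= linearZ dd add0r scalerN subrr.
- by rewrite raddfD /= linearZ dd add0r scalerN subrr.
- by rewrite (raddfN (d n)) opprK /= dd.
Qed.

End Cone.

Section ConeHomotopy.
Variable R : comNzRingType.
Variables (C : nat -> lmodType R) (d : forall n, {linear C n.+1 -> C n}).
Variables (x : R) (d' : forall n, {linear cone C n.+1 -> cone C n}).
Hypothesis d'E : forall n, d' n =1 @cone_dif R C d x n.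

(** The homotopy is [h] on the first summand and [- h] on the shifted one, the sign matching that of
    [- d] in [cone_dif]. *)
Lemma cone_null_homotopic y : null_homotopic d y -> null_homotopic d' y.
Proof.
case=> h [hL h0 hS].
have hN n u : h n (- u) = - h n u.
  by have [g gE] := linear_pack (hL n); rewrite -!gE raddfN.
have hDZ n u v : h n (u + x *: v) = h n u + x *: h n v.
  by rewrite addrC hL addrC.
pose h' n : cone C n -> cone C n.+1 :=
  match n return cone C n -> cone C n.+1 with
  | 0 => fun a => (h 0%N a, 0)
  | m.+1 => fun ab => (h m.+1 ab.1, - h m ab.2)
  end.
exists h'; split=> [[|n] a|a|[|n] [a b]].
- move=> u v; rewrite /h' hL; congr (_, _).
  by rewrite /= scaler0 addr0.
- move=> [u u'] [v v']; rewrite /h' /= !hL; congr (_, _).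
  by rewrite /= opprD scalerN.
- by rewrite d'E /cone_dif /= h0 scaler0 addr0.
- rewrite !d'E /cone_dif /= hDZ; congr (_, _) => /=.
    by rewrite addrACA scalerN addNr addr0 hS.
  by rewrite (raddfN (d 0%N)) opprK /= addr0 h0.
- rewrite !d'E /cone_dif /= hDZ; congr (_, _) => /=.
    by rewrite addrACA scalerN addNr addr0 hS.
  by rewrite (raddfN (d n.+1)) hN !opprK /= hS.
Qed.

(** The homotopy moves the first summand identically to the shifted summand one degree up, from
    which the differential brings back [x] times it. *)
Lemma cone_null_homotopic_self : null_homotopic d' x.
Proof.
pose h' n : cone C n -> cone C n.+1 :=
  match n return cone C n -> cone C n.+1 with
  | 0 => fun a => (0, a)
  | m.+1 => fun ab => (0, ab.1)
  end.
exists h'; split=> [[|n] a|a|[|n] [a b]].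
- by move=> u v; rewrite /h'; congr (_, _); rewrite /= scaler0 addr0.
- move=> [u u'] [v v']; rewrite /h' /=; congr (_, _).
  by rewrite /= scaler0 addr0.
- by rewrite d'E /cone_dif /= raddf0 add0r.
- rewrite !d'E /cone_dif /=; congr (_, _) => /=.
    by rewrite raddf0 add0r addr0.
  by rewrite addrA addNr add0r.
- rewrite !d'E /cone_dif /=; congr (_, _) => /=.
    by rewrite raddf0 add0r addr0.
  by rewrite addrA addNr add0r.
Qed.

End ConeHomotopy.

(** * Koszul complexes and minimal exact complexes *)

Section FiniteDepth.
Variable R : noethLocalRingType.
Variable T : free_complex R.
Hypothesis exT : forall k, exact_dif T k R^o.

Lemma exact_prod k (U V : lmodType R) :
  exact_dif T k U -> exact_dif T k V -> exact_dif T k (U * V)%type.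
Proof.
move=> exU exV.
have [|i iE] := @linear_pack R U (U * V)%type (fun u => (u, 0)).
  by move=> a u v; congr (_, _); rewrite /= scaler0 addr0.
have [|p pE] := @linear_pack R (U * V)%type V (fun uv => uv.2).
  by move=> a u v.
have se : short_exact i p.
  split=> [u v|v|[u v]]; first by rewrite !iE => -[].
    by exists (0, v); rewrite pE.
  rewrite pE /=; split=> [->|[w]]; first by exists u; rewrite iE.
  by rewrite iE => -[].
exact: (exact_extension se (dif_dif _ _) exU exV).
Qed.

(* The Koszul complex on s, obtained from R by iterated mapping cones; eps
   witnesses that its homology in degree 0 is nonzero. *)
Lemma koszul_complex (s : seq R) : (forall x, x \in s -> maxid x) ->
  exists (C : nat -> lmodType R) (d : forall n, {linear C n.+1 -> C n})
      (eps : {linear C 0%N -> R^o}),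
    [/\ forall n a, d n (d n.+1 a) = 0,
        forall n k, exact_dif T k (C n),
        exists l, forall n, (l <= n)%N -> trivial (C n),
        (exists v, eps v = 1) /\ forall a, maxid (eps (d 0%N a)) &
        forall y, y \in s -> null_homotopic d y].
Proof.
have [[m0 mD] _ _] := @maxid_maximal R.
elim: s => [|x s IHs] sm.
  pose K n : lmodType R :=
    if n is 0 then R^o : lmodType R else 'rV[R]_0 : lmodType R.
  exists K, (fun n => \0), (idfun : {linear R^o -> R^o}).
  split=> //.
  - by move=> [|n] k; [exact: exT|apply: exact_trivial; exact: trivial_rV0].
  - by exists 1%N => -[|n] // _; exact: trivial_rV0.
  - by split=> [|a]; [exists 1|].
have [|C [d [eps [dd exC [l C0] [[v v1] epsd] sH]]]] := IHs.
  by move=> y ys; apply: sm; rewrite in_cons ys orbT.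
have /(_ _)/cid D n := linear_pack (cone_dif_linear d x (n := n)).
pose d' n := sval (D n); have d'E n : d' n =1 cone_dif d x (n := n) := svalP (D n).
exists (cone C), d', eps; split.
- by move=> n a; rewrite !d'E cone_dif_dif.
- by case=> [|n] k; [exact: exC|apply: exact_prod; exact: exC].
- exists l.+1 => -[|n] // ln [a b]; have ln' : (l <= n)%N := ln.
  by rewrite (C0 _ (leqW ln') a) (C0 _ ln' b).
- split=> [|[a b]]; first by exists v.
  (* Boundaries of the cone in degree 0 are [d a + x b]; since [x] is in the maximal ideal, [eps]
     still sends them there. *)
  rewrite d'E /= raddfD /= linearZ /= addrC [_ *: _]mulrC; apply: mD => //.
  by apply: sm; rewrite mem_head.
move=> y; rewrite in_cons => /predU1P[->|/sH yH].
  exact: cone_null_homotopic_self d'E.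
exact: cone_null_homotopic d'E _ yH.
Qed.

Hypothesis rkT0 : rk T 0 = 0%N.
Hypothesis rkT1 : (0 < rk T 1)%N.
Hypothesis minT : forall i j, maxid (dif T 1 i j).

(** Since [rk T 0 = 0], exactness at index 0 makes [dif T 1] injective on [X^(rk T 1)]; by
    minimality it kills the vector with [v] in one place and zeros elsewhere. *)
Lemma exact_socle (X : lmodType R) (v : X) : exact_dif T 0 X ->
  (forall y, maxid y -> y *: v = 0) -> v = 0.
Proof.
move=> exX vm; pose j := Ordinal rkT1.
pose phi : {ffun 'I_(rk T 1) -> X} := [ffun i => if i == j then v else 0].
have [|psi /ffunP/(_ j)] := exX phi.
  apply/ffunP => i; rewrite hom_difE ffunE big1 // => k _; rewrite ffunE.
  by case: eqP => _; rewrite ?scaler0 // vm.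
rewrite !ffunE eqxx => <-; rewrite big1 // => -[k kT]; by exfalso; rewrite rkT0 in kT.
Qed.

(* If the top nonvanishing homology of the Koszul complex on generators of the
   maximal ideal sits in degree n, then coker (d n) has a socle element and a
   finite resolution by free modules. *)
Lemma no_minimal_exact_complex : False.
Proof.
have [mI _ _] := @maxid_maximal R.
have [k [g gm]] : fg_ideal (maxid : set R) by exact: noetherian mI.
have [|C [d [eps [dd exC [l C0] [[v v1] epsd] gH]]]] := @koszul_complex (codom g).
  move=> _ /codomP[i ->]; apply/gm; exists (fun j => (j == i)%:R).
  rewrite (bigD1 i) //= eqxx mul1r big1 ?addr0 // => j /negbTE ->.
  by rewrite mul0r.
pose pi n : {linear C n -> coker (d n)} := quotpi _.
have piE n z : pi n z = 0 <-> exists w, d n w = z.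
  rewrite -(raddf0 (pi n)) quotpi_eq subr0.
  by split=> [/asboolP|?]; last exact/asboolP.
have soc n z : (forall i, exists w, d n w = g i *: z) ->
    forall y, maxid y -> y *: pi n z = 0.
  move=> zH y /gm[c ->]; rewrite scaler_suml big1 // => i _.
  rewrite -scalerA; have -> : g i *: pi n z = pi n (g i *: z) by rewrite linearZ.
  by have /piE -> := zH i; rewrite scaler0.
(* The descent goes from degree [l], where the cokernel vanishes, to 0: without socle elements in
   [coker (d n.+1)] there is no homology in degree [n.+1], so this cokernel embeds in [C n] with
   quotient [coker (d n)]. In degree 0, [v] would be a boundary although [eps v = 1]. *)
have exD n : (forall j, exact_dif T j (coker (d n))) -> False.
  elim: n => [|n IHn] exD.
    have /piE[w dw] : pi 0%N v = 0.
      apply: (exact_socle (@exD 0%N)); apply: soc => i.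
      by apply: null_homotopic_cycle0; apply: gH; exact: codom_f.
    by have [_ + _] := @maxid_maximal R; apply; rewrite -v1 -dw.
  apply: IHn => j.
  have [|f fE] := @linear_quotmod R _ _ _ (img_submod (d n.+1)) (d n).
    by move=> _ /asboolP[w <-].
  have fI w : f w = 0 -> w = 0.
    rewrite -[w]quotreprK fE => dw.
    apply: (exact_socle (@exD 0%N)); apply: soc => i.
    by apply: null_homotopic_cycle dw; apply: gH; exact: codom_f.
  have se : short_exact f (pi n).
    split=> [y z /eqP|y|y].
    - by rewrite -subr_eq0 -raddfB => /eqP/fI/eqP; rewrite subr_eq0 => /eqP.
    - by exists (quotrepr y); exact: quotreprK.
    rewrite piE; split=> -[w <-]; first by exists (pi n.+1 w); rewrite fE.
    by exists (quotrepr w); rewrite -fE quotreprK.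
  exact: (exact_quotient se (dif_dif _ _) (@exC _ _) (@exD _)).
apply: (exD l) => j; apply: exact_trivial => y.
by rewrite -[y]quotreprK (C0 l _ (quotrepr y)) // raddf0.
Qed.

End FiniteDepth.

Lemma isomorphic_bij (R : comNzRingType) (V W : lmodType R) (g : {linear V -> W}) :
  injective g -> (forall w, exists v, g v = w) -> isomorphic W V.
Proof.
move=> gI /choice[h hK]; have [|f fE] := @linear_pack R W V h.
  by move=> a u v; apply: gI; rewrite linearP !hK.
by exists f; exists g => v; [|apply: gI]; rewrite fE hK.
Qed.

(** * Tensor products by generators and relations *)

Section TensorTheory.
Variable R : comNzRingType.
Variables A B : lmodType R.

Definition pure (a : A) (b : B) : tensor A B :=
  quotpi (tensor_null_submod A B) << (a, b) >>.

Lemma freegUZ (K : choiceType) c k (x : K) :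
  c *: << k *g x >> = << c * k *g x >> :> {freeg K / R}.
Proof. by apply/eqP/freeg_eqP => z; rewrite coeffZ !coeffU mulrA. Qed.

Lemma tensor_rel_eq0 D : tensor_rel D -> quotpi (tensor_null_submod A B) D = 0.
Proof.
move=> relD; rewrite -(raddf0 (@quotpi R _ _ (tensor_null_submod A B))).
apply/quotpi_eq; rewrite subr0; apply/asboolP.
exists 1%N, (fun=> 1), (fun=> D); split=> //.
by rewrite big_ord1 scale1r.
Qed.

Lemma pureDl a a' b : pure (a + a') b = pure a b + pure a' b.
Proof.
apply/eqP; rewrite -subr_eq0 opprD addrA -!raddfB /=; apply/eqP.
by apply: tensor_rel_eq0; left; exists a, a', b.
Qed.

Lemma pureDr a b b' : pure a (b + b') = pure a b + pure a b'.
Proof.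
apply/eqP; rewrite -subr_eq0 opprD addrA -!raddfB /=; apply/eqP.
by apply: tensor_rel_eq0; right; left; exists a, b, b'.
Qed.

Lemma pureZl r a b : pure (r *: a) b = r *: pure a b.
Proof.
apply/eqP; rewrite -subr_eq0 -linearZ -raddfB /=; apply/eqP.
by apply: tensor_rel_eq0; right; right; left; exists r, a, b.
Qed.

Lemma pureZr r a b : pure a (r *: b) = r *: pure a b.
Proof.
apply/eqP; rewrite -subr_eq0 -linearZ -raddfB /=; apply/eqP.
by apply: tensor_rel_eq0; right; right; right; exists r, a, b.
Qed.

Lemma tensor_ind (P : tensor A B -> Prop) : P 0 ->
  (forall r a b t, P t -> P (r *: pure a b + t)) -> forall t, P t.
Proof.
move=> P0 PD t; rewrite -[t]quotreprK -(freeg_sumE (quotrepr t)).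
elim: (dom _) => [|[a b] s IHs]; first by rewrite big_nil raddf0.
by rewrite big_cons -[coeff _ _]mulr1 -freegUZ raddfD /= linearZ; exact: PD.
Qed.

(** Universal property: [b] extends to the free module on [A * B], and bilinearity makes the
    extension vanish on the relations. *)
Lemma tensor_lift (W : lmodType R) (b : A -> B -> W) :
  (forall y, linear (b^~ y)) -> (forall x, linear (b x)) ->
  exists g : {linear tensor A B -> W}, forall x y, g (pure x y) = b x y.
Proof.
move=> bl br; pose f (xy : A * B) := b xy.1 xy.2.
have fgl : linear (fglift f).
  pose M := GRing.isZmodMorphism.Build _ _ (fglift f) (lift_is_additive f).
  pose F : {additive {freeg (A * B) / R} -> W} := HB.pack (fglift f) M.
  have fD : {morph fglift f : u v / u + v} := raddfD F.
  have f0 : fglift f 0 = 0 := raddf0 F.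
  have fZ c (D : {freeg (A * B) / R}) : fglift f (c *: D) = c *: fglift f D.
    rewrite -[D]freeg_sumE; elim/big_rec: _ => [|z u _ IHu].
      by rewrite scaler0 f0 scaler0.
    by rewrite scalerDr !fD IHu scalerDr freegUZ !liftU scalerA.
  by move=> a u v; rewrite fD fZ.
have [F FE] := linear_pack fgl.
have bDl x x' y : b (x + x') y = b x y + b x' y.
  by have := bl y 1 x x'; rewrite !scale1r.
have bDr x y y' : b x (y + y') = b x y + b x y'.
  by have := br x 1 y y'; rewrite !scale1r.
have b0l y : b 0 y = 0 by apply: (addIr (b 0 y)); rewrite -bDl !add0r.
have b0r x : b x 0 = 0 by apply: (addIr (b x 0)); rewrite -bDr !add0r.
have bZl r x y : b (r *: x) y = r *: b x y.
  by have := bl y r x 0; rewrite !addr0 b0l addr0.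
have bZr r x y : b x (r *: y) = r *: b x y.
  by have := br x r y 0; rewrite !addr0 b0r addr0.
have FU x y : F << (x, y) >> = b x y by rewrite FE liftU scale1r.
have Frel D : tensor_rel D -> F D = 0.
  case=> [[a [a' [y ->]]]|[[a [y [y' ->]]]|[[r [a [y ->]]]|[r [a [y ->]]]]]].
  - by rewrite !raddfB /= !FU bDl addrAC addrK subrr.
  - by rewrite !raddfB /= !FU bDr addrAC addrK subrr.
  - by rewrite raddfB /= linearZ /= !FU bZl subrr.
  - by rewrite raddfB /= linearZ /= !FU bZr subrr.
have [|g gE] := @linear_quotmod R _ _ _ (tensor_null_submod A B) F.
  move=> D /asboolP[k [c [T [Trel ->]]]]; rewrite linear_sum big1 // => i _.
  by rewrite linearZ /= Frel ?scaler0.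
by exists g => x y; rewrite gE FU.
Qed.

End TensorTheory.

(** * Homology with coefficients compared with a tensor product *)

Section HomologyTensor.
Variable R : comNzRingType.
Implicit Types U V W N : lmodType R.

Lemma homology_eq0 U V W (f : {linear U -> V}) (g : {linear V -> W}) z :
  quotpi (boundary_submod f g) z = 0 <-> exists u, f u = val z.
Proof.
rewrite -(raddf0 (@quotpi R _ _ (boundary_submod f g))) quotpi_eq subr0.
by split=> [/asboolP|?]; last exact/asboolP.
Qed.

Lemma trivial_homology U V W (f : {linear U -> V}) (g : {linear V -> W}) :
  trivial (homology f g) <-> forall v, g v = 0 -> exists u, f u = v.
Proof.
split=> [H0 v /eqP gv|ex x].
  by have /homology_eq0 := H0 (quotpi _ (Sub v gv : kermod g)).
rewrite -[x]quotreprK; apply/homology_eq0/ex; apply/eqP.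
exact: (valP (quotrepr x)).
Qed.

(** The image of [z (x) y] under the identification of [R^m (x) N] with [N^m]. *)
Definition act N m (z : {ffun 'I_m -> R^o}) (y : N) : {ffun 'I_m -> N} :=
  [ffun i => (z i : R) *: y].

Lemma hom_dif_act N p m (B : 'M[R]_(p, m)) z (y : N) :
  hom_dif B N (act z y) = act (hom_dif B R^o z) y.
Proof.
apply/ffunP => i; rewrite !ffunE scaler_suml.
by apply: eq_bigr => j _; rewrite ffunE scalerA.
Qed.

Lemma act_linearl N m (y : N) : linear (fun z : {ffun 'I_m -> R^o} => act z y).
Proof. by move=> a u v; apply/ffunP => i; rewrite !ffunE scalerDl scalerA. Qed.

Lemma act_linearr N m (z : {ffun 'I_m -> R^o}) : linear (@act N m z).
Proof.
move=> a u v; apply/ffunP => i; rewrite !ffunE scalerDr !scalerA.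
by rewrite mulrC.
Qed.

Lemma hom_dif_sum_act N p m (B : 'M[R]_(p, m)) (y : {ffun 'I_m -> N}) :
  hom_dif B N y = \sum_j act [ffun i => B i j] (y j).
Proof.
apply/ffunP => i; rewrite hom_difE sum_ffunE.
by apply: eq_bigr => j _; rewrite !ffunE.
Qed.

Lemma hom_dif_delta p m (B : 'M[R]_(p, m)) j :
  hom_dif B R^o [ffun i => (i == j)%:R] = [ffun i => B i j].
Proof.
apply/ffunP => i; rewrite hom_difE ffunE (bigD1 j) //= big1 => [|k /negbTE kj].
  by rewrite ffunE eqxx addr0 [LHS]mulr1.
by rewrite ffunE kj [LHS]mulr0.
Qed.

Section Comparison.
Variables (N U U' : lmodType R) (p m l k : nat).
Variables (B : 'M[R]_(p, m)) (Z : 'M[R]_(m, l)) (W : 'M[R]_(l, k)).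
Variables (f : {linear U -> {ffun 'I_m -> R^o}})
          (f' : {linear U' -> {ffun 'I_m -> N}}).
Hypothesis Bf : forall u, hom_dif B R^o (f u) = 0.
Hypothesis f'_span : forall u', exists n (s : 'I_n -> U) (y : 'I_n -> N),
  f' u' = \sum_i act (f (s i)) (y i).
Hypothesis act_f : forall u y, exists u', f' u' = act (f u) y.
Hypotheses (BZ : B *m Z = 0) (ZW : Z *m W = 0).
Hypothesis exBZ : exact_at B Z R^o.

Let E := homology f (hom_dif B R^o).
Let X := homology f' (hom_dif B N).
Let piE : {linear kermod (hom_dif B R^o) -> E} :=
  quotpi (boundary_submod f (hom_dif B R^o)).
Let piX : {linear kermod (hom_dif B N) -> X} :=
  quotpi (boundary_submod f' (hom_dif B N)).

Let col_ker j : [ffun i => Z i j] \in ker (hom_dif B R^o).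
Proof.
by apply/eqP; rewrite /= -(hom_dif_delta Z j) hom_dif_mul BZ hom_dif0.
Qed.

Let zc j : kermod (hom_dif B R^o) := Sub [ffun i => Z i j] (col_ker j).

Let cls (c : 'I_l -> R) : E := \sum_j c j *: piE (zc j).

Let val_sum (c : 'I_l -> R) :
  val (\sum_j c j *: zc j) = hom_dif Z R^o [ffun j => c j].
Proof.
rewrite raddf_sum hom_dif_sum_act; apply: eq_bigr => j _.
rewrite [LHS]linearZ; apply/ffunP => i; rewrite !ffunE.
by rewrite [LHS]mulrC.
Qed.

Let clsE c : cls c = piE (\sum_j c j *: zc j).
Proof. by rewrite linear_sum; apply: eq_bigr => j _; rewrite linearZ. Qed.

(** By exactness over [R] the columns of [Z] span the kernel of [hom_dif B R^o], so their classes
    generate [E]. *)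
Let cls_surj x : exists c, x = cls c.
Proof.
have /exBZ[c cE] : hom_dif B R^o (val (quotrepr x)) = 0.
  by apply/eqP; exact: (valP (quotrepr x)).
exists c; rewrite clsE -[LHS]quotreprK; congr quotpi; apply: val_inj.
rewrite val_sum -cE; congr hom_dif.
by apply/ffunP => j; rewrite ffunE.
Qed.

Lemma homology_fg : finitely_generated E.
Proof. by exists l, (fun j => piE (zc j)) => v; have [c ->] := cls_surj v; exists c. Qed.

Hypothesis exBZN : exact_at B Z N.
Hypothesis exZWN : exact_at Z W N.

(** The surjection [R^l -> E] given by the columns of [Z], tensored with [N], with [R^l (x) N] read
    as [N^l]. *)
Let tau (y : {ffun 'I_l -> N}) : tensor E N := \sum_j pure (piE (zc j)) (y j).

Let tau_linear : linear tau.
Proof.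
move=> a u v; rewrite /tau scaler_sumr -big_split; apply: eq_bigr => j _.
by rewrite !ffunE pureDr pureZr.
Qed.

Let tau_act c y : tau (act c y) = pure (cls c) y.
Proof.
rewrite /cls; pose P (u : tensor E N) (v : E) := u = pure v y.
apply: (big_ind2 P) => [|u v u' v' -> ->|j _]; rewrite /P.
- by have := pureZl 0 (0 : E) y; rewrite !scale0r.
- by rewrite pureDl.
- by rewrite ffunE pureZr pureZl.
Qed.

Let tau_surj t : exists y, t = tau y.
Proof.
have [T TE] := linear_pack tau_linear.
elim/tensor_ind: t => [|r x y t [w ->]]; first by exists 0; rewrite -TE raddf0.
have [c ->] := cls_surj x.
by exists (r *: act [ffun j => c j] y + w); rewrite tau_linear tau_act;
  congr (_ *: pure _ _ + _); apply: eq_bigr => j _; rewrite ffunE.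
Qed.

Let act_ker (z : kermod (hom_dif B R^o)) y : act (val z) y \in ker (hom_dif B N).
Proof.
apply/eqP; rewrite /= hom_dif_act; have /eqP /= -> := valP z.
by apply/ffunP => i; rewrite !ffunE scale0r.
Qed.

Let actk (z : kermod (hom_dif B R^o)) y : kermod (hom_dif B N) :=
  Sub (act (val z) y) (act_ker z y).

(** By [f'_span] and [act_f] the image of [f'] is that of [f (x) N]. Then [E (x) N] and [X] are both
    quotients of [N^l], by [tau] and by [Z] followed by [piX]: [exBZN] gives surjectivity of the
    comparison map and [exZWN] its injectivity. *)
Lemma homology_tensor : isomorphic X (tensor E N).
Proof.
have actk_l y : linear (actk^~ y).
  by move=> a u v; apply: val_inj; rewrite [RHS]linearP !SubK -act_linearl; congr (act _ y); exact: linearP.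
have actk_r z : linear (actk z).
  by move=> a u v; apply: val_inj; rewrite [RHS]linearP !SubK act_linearr.
(* The choice of representative is harmless: two of them differ by some [f u], which [act_f] turns
   into a boundary over [N]. *)
pose b (x : E) y := piX (actk (quotrepr x) y).
have bE z y : b (piE z) y = piX (actk z y).
  have actkB z' : actk z' y - actk z y = actk (z' - z) y.
    by have [F FE] := linear_pack (actk_l y); rewrite -!FE raddfB.
  apply/eqP; rewrite -subr_eq0 -(raddfB piX) actkB; apply/eqP.
  apply/homology_eq0; rewrite SubK.
  have : piE (quotrepr (piE z) - z) = 0.
    by apply/eqP; rewrite raddfB subr_eq0; apply/eqP; exact: quotreprK.
  by move=> /homology_eq0[u <-]; exact: act_f.
have b_l y : linear (b^~ y).
  move=> a x x'; rewrite -[x]quotreprK -[x']quotreprK -linearP !bE actk_l.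
  by rewrite linearP.
have b_r x : linear (b x) by move=> a y y'; rewrite /b actk_r linearP.
have [g gE] := tensor_lift b_l b_r.
have gtau y : exists2 z, val z = hom_dif Z N y & g (tau y) = piX z.
  exists (\sum_j actk (zc j) (y j)).
    by rewrite raddf_sum hom_dif_sum_act; apply: eq_bigr.
  by rewrite !linear_sum; apply: eq_bigr => j _; rewrite gE bE.
apply: (@isomorphic_bij _ _ _ g) => [t t'|x]; last first.
  have /exBZN[y yE] : hom_dif B N (val (quotrepr x)) = 0.
    by apply/eqP; exact: (valP (quotrepr x)).
  have [z zE gz] := gtau y; exists (tau y); rewrite gz -[RHS]quotreprK.
  by congr quotpi; apply: val_inj; rewrite zE yE.
move=> /eqP; rewrite -subr_eq0 -raddfB /= => /eqP gt0; apply/eqP.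
rewrite -subr_eq0; apply/eqP; move: gt0; have [y ->] := tau_surj (t - t').
have [z zE ->] := gtau y => /homology_eq0[u' u'E].
have [n [s [w f'E]]] := f'_span u'.
have /choice[c cE] : forall i, exists c, hom_dif Z R^o c = f (s i).
  by move=> i; exact: exBZ.
(* [Z] sends [y] and the sum to the same boundary, so they differ by an element of the image of [W].
   Then [tau] kills both parts, since [Z] sends the columns of [W] and each [c i] into the image of
   [f]. *)
have [|v vE] := @exZWN (y - \sum_i act (c i) (w i)).
  rewrite raddfB /= -zE -u'E f'E raddf_sum /=; apply/eqP; rewrite subr_eq0.
  by apply/eqP/eq_bigr => i _; rewrite hom_dif_act cE.
have [T TE] := linear_pack tau_linear.
have tau0 d x : (exists u, f u = hom_dif Z R^o d) -> T (act d x) = 0.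
  move=> dE; rewrite TE tau_act clsE (_ : piE _ = 0).
    by have := pureZl 0 (0 : E) x; rewrite !scale0r.
  apply/homology_eq0; rewrite val_sum.
  by rewrite (_ : [ffun j => d j] = d) //; apply/ffunP => j; rewrite ffunE.
rewrite -(subrK (\sum_i act (c i) (w i)) y) -vE -TE raddfD hom_dif_sum_act.
rewrite !raddf_sum !big1 ?addr0 // => i _; apply: tau0.
  by exists (s i).
by exists 0; rewrite raddf0 -hom_dif_delta hom_dif_mul ZW hom_dif0.
Qed.

End Comparison.

End HomologyTensor.

(** * Truncating a complex and adding a term in front *)

Section Complexes.
Variable R : comNzRingType.

Lemma isomorphic_trivial (V W : lmodType R) :
  isomorphic V W -> trivial V -> trivial W.
Proof. by move=> [f [g _ fK]] V0 w; rewrite -(fK w) (V0 (g w)) raddf0. Qed.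

Definition shift_rk (F : free_complex R) n k := rk F (k + n).
Definition shift_dif (F : free_complex R) n k :
  'M[R]_(shift_rk F n k.+1, shift_rk F n k) := dif F (k + n).
Definition shift (F : free_complex R) n : free_complex R :=
  @FreeComplex R (shift_rk F n) (shift_dif F n) (fun k => dif_dif F (k + n)).

Section Extend.
Variables (T : free_complex R) (l : nat) (A : 'M[R]_(rk T 0, l)).
Hypothesis TA : dif T 0 *m A = 0.

Definition extend_rk k := if k is k'.+1 then rk T k' else l.
Definition extend_dif k : 'M[R]_(extend_rk k.+1, extend_rk k) :=
  match k return 'M[R]_(extend_rk k.+1, extend_rk k) with
  | 0 => A
  | k'.+1 => dif T k'
  end.
Lemma extend_dif_dif k : extend_dif k.+1 *m extend_dif k = 0.
Proof. by case: k => [|k]; [exact: TA|exact: dif_dif]. Qed.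
Definition extend : free_complex R := FreeComplex extend_dif_dif.

Lemma exact_extend Y : exact_at (dif T 0) A Y ->
  (forall k, exact_dif T k Y) -> forall k, exact_dif extend k Y.
Proof. by move=> ex0 exT [|k]; [exact: ex0|exact: exT]. Qed.

End Extend.
End Complexes.

(** * Ext with coefficients of reducible complexity *)

Section ExtOfReducible.
Variable R : noethLocalRingType.
Implicit Types M N X Y : lmodType R.

(** [hom_dif B] multiplies column vectors while [minimal_syzygy] treats row vectors; transposition
    passes from one to the other. *)
Lemma dual_syzygy p q (B : 'M[R]_(p, q)) : exists l (Z : 'M[R]_(q, l)),
  B *m Z = 0 /\ exact_at B Z R^o.
Proof.
have [l [Z [ZP _]]] := minimal_syzygy B^T.
exists l, Z^T; split.
  apply: trmx_inj; rewrite trmx_mul trmxK trmx0; apply/row_matrixP => i.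
  by rewrite row_mul row0; apply/ZP; exists (delta_mx 0 i); rewrite -rowE.
move=> phi phi0; have [|w wE] := (ZP (\row_j phi j)).1.
  apply/rowP => i; have /ffunP/(_ i) := phi0; rewrite hom_difE !ffunE !mxE => e.
  by apply: etrans e; apply: eq_bigr => j _; rewrite !mxE mulrC.
exists [ffun j => w 0 j]; apply/ffunP => j; rewrite hom_difE.
have /rowP/(_ j) := wE; rewrite !mxE => ->.
by apply: eq_bigr => k _; rewrite ffunE !mxE [LHS]mulrC.
Qed.

(** Stands in for a nonzero map to the residue field: a coefficient along a minimal generating
    family, linear modulo the maximal ideal because every relation in the family has its
    coefficients there. *)
Lemma residue_functional (V : lmodType R) :
  finitely_generated V -> ~ trivial V ->
  exists (lam : V -> R) v, [/\ ~ maxid (lam v) &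
    forall a u w, maxid (lam (a *: u + w) - (a * lam u + lam w))].
Proof.
have [[m0 mD] m1 _] := @maxid_maximal R; move=> [k [g gV]] V0.
have [|[|b] [h [hV hm]]] := @minimal_generators R V setT k g; first by split.
  case: V0 => v; have [|c ->] := (hV v).1; first by [].
  by rewrite big_ord0.
have /choice[c cE] : forall v, exists c : 'I_b.+1 -> R, v = \sum_i c i *: h i.
  by move=> v; exact: (hV v).1.
have cm v e : v = \sum_i e i *: h i -> maxid (c v ord0 - e ord0).
  move=> ve; apply: (hm (fun i => c v i - e i)).
  under eq_bigr do rewrite scalerBl.
  by rewrite sumrB -cE -ve subrr.
exists (c^~ ord0), (h ord0); split=> [c0|a u w].
  apply: m1; have : maxid (c (h ord0) ord0 - 1).
    apply: (cm _ (fun i => (i == ord0)%:R)).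
    rewrite (bigD1 ord0) //= scale1r big1 ?addr0 // => i /negbTE ->.
    by rewrite scale0r.
  by move=> /(mD (-1) _ _)/(_ c0); rewrite mulN1r opprB subrK.
apply: (cm _ (fun i => a * c u i + c w i)).
rewrite {1}(cE u) {1}(cE w) scaler_sumr -big_split; apply: eq_bigr => i _.
by rewrite /= scalerDl scalerA.
Qed.

(** Modulo the maximal ideal [lam x * mu y] is bilinear, and it is nonzero at [(v, w)] because
    elements outside the ideal are units. *)
Lemma tensor_nontrivial (V W : lmodType R) :
  finitely_generated V -> finitely_generated W ->
  ~ trivial V -> ~ trivial W -> ~ trivial (tensor V W).
Proof.
move=> Vfg Wfg V0 W0 VW0.
have [[m0 mD] m1 _] := @maxid_maximal R.
have [lam [v [lv lamP]]] := residue_functional Vfg V0.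
have [mu [w [mw muP]]] := residue_functional Wfg W0.
have mM (a x : R) : maxid x -> maxid (a * x).
  by move=> mx; have := mD a _ _ mx m0; rewrite addr0.
pose S : {pred R^o} := fun x => `[< maxid x >].
have S_submod : submod_closed S.
  split=> [|a x y /asboolP mx /asboolP my]; apply/asboolP; first exact: m0.
  exact: mD.
pose b x y := quotpi S_submod (lam x * mu y : R^o).
have [|x|g gE] := @tensor_lift R V W _ b.
- move=> y a x x'; rewrite /b -linearP; apply/quotpi_eq/asboolP.
  have := mM (mu y) _ (lamP a x x').
  by rewrite mulrC mulrBl mulrDl -mulrA.
- move=> a y y'; rewrite /b -linearP; apply/quotpi_eq/asboolP.
  have := mM (lam x) _ (muP a y y').
  by rewrite mulrBr mulrDr (mulrCA (lam x) a).
have : b v w = 0 by rewrite -gE (VW0 (pure v w)) raddf0.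
rewrite -(raddf0 (quotpi S_submod)) => /quotpi_eq; rewrite subr0 => /asboolP mvw.
have [y yv] := notin_maxid lv; apply: mw.
by rewrite -[mu w]mul1r -yv -mulrA; exact: mM.
Qed.

Lemma trivial_ExtS i M Y :
  trivial (Ext i.+1 M Y) <-> exact_dif (min_res M) i Y.
Proof. exact: trivial_homology. Qed.

(** Puts [Ext 0], with zero incoming map, and [Ext n.+1], with a dual differential coming in, into
    the single form that [homology_tensor] expects. *)
Lemma Ext_homology n M N (F := min_res M) :
  exists (U U' : lmodType R) (f : {linear U -> {ffun 'I_(rk F n) -> R^o}})
      (f' : {linear U' -> {ffun 'I_(rk F n) -> N}}),
    [/\ Ext n M R^o = homology f (hom_dif (dif F n) R^o),
        Ext n M N = homology f' (hom_dif (dif F n) N),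
        forall u, hom_dif (dif F n) R^o (f u) = 0,
        forall u', exists m (s : 'I_m -> U) (y : 'I_m -> N),
          f' u' = \sum_i act (f (s i)) (y i) &
        forall u y, exists u', f' u' = act (f u) y].
Proof.
case: n => [|n].
  exists R^o, N, \0, \0; split=> // [u|u'|u y]; first exact: raddf0.
    have s : 'I_0 -> R^o by case.
    have y : 'I_0 -> N by case.
    by exists 0%N, s, y; rewrite big_ord0.
  by exists 0; apply/ffunP => i; rewrite !ffunE scale0r.
exists {ffun 'I_(rk F n) -> R^o}, {ffun 'I_(rk F n) -> N}.
exists (hom_dif (dif F n) R^o), (hom_dif (dif F n) N); split=> // [u|u'|u y].
- by rewrite /= hom_dif_mul dif_dif hom_dif0.
- exists (rk F n), (fun j => [ffun i => (i == j)%:R]), u'.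
  rewrite /= hom_dif_sum_act; apply: eq_bigr => j _.
  by rewrite hom_dif_delta.
- by exists (act u y); rewrite /= hom_dif_act.
Qed.

Lemma Ext_vanishing_tensor M N n :
  reducible_complexity N ->
  (forall i, (n < i)%N -> trivial (Ext i M R^o)) ->
  (\forall i \near \oo, trivial (Ext i M N)) ->
  [/\ forall i, (n < i)%N -> trivial (Ext i M N),
      isomorphic (Ext n M N) (tensor (Ext n M R^o) N) &
      finitely_generated (Ext n M R^o)].
Proof.
move=> Nred ExtR [k0 _ ExtN]; set F := min_res M.
(* The dual of [F] from degree [n] on is prolonged to the left: [Z] covers the kernel of the dual
   differential leaving degree [n], and [W] covers the kernel of [Z]. *)
have [l [Z [BZ exBZ]]] := dual_syzygy (dif (shift F n) 0).
have [l' [W [ZW exZW]]] := dual_syzygy Z.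
pose T' := extend BZ; pose T := @extend R T' l' W ZW.
have exT : forall k, exact_dif T k R^o.
  apply: exact_extend => //; apply: exact_extend => // k.
  apply/trivial_ExtS/ExtR; rewrite ltnS; exact: leq_addl.
have exTN : forall k, exact_dif T k N.
  (* Because of the two added terms, index [k.+2] of [T] stands for [Ext (k + n).+1]; hence the
     bound [k0.+2]. *)
  apply: exact_reducible => //; exists k0.+2 => -[|[|k]] // k0k.
  apply/trivial_ExtS/ExtN => /=.
  by rewrite -addSn (leq_trans _ (leq_addr _ _)) // ltnW.
have exFN i : (n < i)%N -> trivial (Ext i M N).
  case: i => // i; rewrite ltnS => ni; apply/trivial_ExtS.
  by have := @exTN (i - n).+2; rewrite -{2}(subnK ni).
have exBZN : exact_at (dif F n) Z N by exact: (@exTN 1%N).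
have exZWN : exact_at Z W N by exact: (@exTN 0%N).
have [U [U' [f [f' [-> -> Bf f'_span act_f]]]]] := Ext_homology n M N.
split=> //; first exact: (homology_tensor Bf f'_span act_f BZ ZW exBZ).
exact: (homology_fg f BZ exBZ).
Qed.

(** Were [Hom(M, R)] zero, the dual of [F] preceded by a zero term would be exact; it is minimal,
    and [rk F 0] is positive because [M] is nonzero, which [no_minimal_exact_complex] excludes. *)
Lemma Hom_nontrivial M : finitely_generated M -> ~ trivial M ->
  (forall i, (0 < i)%N -> trivial (Ext i M R^o)) -> ~ trivial (Ext 0 M R^o).
Proof.
move=> Mfg M0 ExtR Hom0; set F := min_res M.
have [[e [eS _ _]] minF] := min_resP Mfg.
have F0 : dif F 0 *m (0 : 'M[R]_(rk F 0, 0)) = 0 by rewrite mulmx0.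
apply: (@no_minimal_exact_complex R (extend F0)) => //.
- apply: exact_extend => [phi phi0|k]; last by apply/trivial_ExtS/ExtR.
  have /trivial_homology/(_ phi phi0)[u <-] := Hom0.
  by exists 0; rewrite raddf0.
- rewrite lt0n; apply/eqP => /= rk0; apply: M0 => v; have [u <-] := eS v.
  suff -> : u = 0 by rewrite raddf0.
  by apply/rowP => -[i ilt]; exfalso; rewrite rk0 in ilt.
- by move=> i j; exact: minF.
Qed.

End ExtOfReducible.

Theorem theorem4p4 (R : noethLocalRingType) (M N : lmodType R)
    (M_fg : finitely_generated M) (N_fg : finitely_generated N)
    (M_neq0 : ~ trivial M) (N_neq0 : ~ trivial N)
    (N_red : reducible_complexity N)
    (M_wgd : (wgd M < +oo)%E)
    (Ext_eventually0 : \forall i \near \oo, trivial (Ext i M N)) :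
  exists n : nat,
    [/\ wgd M = n%:R%:E,
        isomorphic (Ext n M N) (tensor (Ext n M R^o) N) &
        wgd M = ereal_sup [set i%:R%:E | i in
                  [set i : nat | ~ trivial (Ext i M N)]]].
Proof.
(* For positive [n] the nonvanishing of [Ext n M R^o] is part of the definition; for [n = 0] it is
   [Hom_nontrivial]. *)
have [n [wn ExtR Extn]] : exists n, [/\ wgd M = n%:R%:E,
    forall i, (n < i)%N -> trivial (Ext i M R^o) & ~ trivial (Ext n M R^o)].
  have := wgdP M; case=> [[w0 ExtR]|[t [wt _ Extt ExtR]]|[winf]].
  - by exists 0%N; split=> //; exact: Hom_nontrivial.
  - by exists t.
  - by rewrite winf ltxx in M_wgd.
have [ExtN iso fgE] := Ext_vanishing_tensor N_red ExtR Ext_eventually0.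
have ExtnN : ~ trivial (Ext n M N).
  by move=> /(isomorphic_trivial iso); exact: tensor_nontrivial.
exists n; split=> //; rewrite wn; apply/eqP; rewrite eq_le; apply/andP; split.
  by apply: ereal_sup_ubound; exists n.
apply: ge_ereal_sup => _ [i Exti <-]; rewrite lee_fin ler_nat leqNgt.
by apply/negP => ni; apply: Exti; exact: ExtN.
Qed.
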